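(* Let $\mathcal H:\mathbb{R}^d\to\mathbb{R}^d$ satisfy $\|\mathcal H(x)-\mathcal H(y)\|_2\le\|x-y\|_2$ for all $x,y$, and suppose its fixed-point set $\mathcal X$ is non-empty and bounded. Fix a deterministic $x_0$, and let $x_{k+1}=x_k+\epsilon_k(\mathcal H(x_k)-x_k+w_k)$ with positive stepsizes, where, with $\mathcal F_k$ the $\sigma$-algebra generated by $x_0,w_0,\dots,x_{k-1},w_{k-1},x_k$, $\mathbb{E}[w_k\mid\mathcal F_k]=0$ and $\mathbb{E}[\|w_k\|_2^2\mid\mathcal F_k]\le A$ for a constant $A>0$. Let $\mathrm{dist}(x,\mathcal X)=\inf_{x^*\in\mathcal X}\|x-x^*\|_2$ and $D=\sup_{x^*\in\mathcal X}\|x_0-x^*\|_2$. Then: (a) if $\sum_k\epsilon_k=\infty$ and $\sum_k\epsilon_k^2<\infty$, then $\mathrm{dist}(x_k,\mathcal X)\to0$ almost surely; (b) if $\epsilon_k\equiv\epsilon\in(0,1)$, then for all $k\ge0$, $\min_{0\le i\le k}\mathbb{E}[\|\mathcal H(x_i)-x_i\|_2^2]\le\frac{D^2}{(k+1)(1-\epsilon)\epsilon}+\frac{A\epsilon}{1-\epsilon}$; (c) if $\epsilon_k=\epsilon/\sqrt{k+1}$ with $\epsilon\in(0,1)$, then for all $k\ge1$, $\min_{0\le i\le k}\mathbb{E}[\|\mathcal H(x_i)-x_i\|_2^2]\le\frac{D^2+A\epsilon^2(1+\log k)}{2(1-\epsilon)\epsilon((k+1)^{1/2}-1)}$; (d)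 if $\epsilon_k=\epsilon/(k+1)$ with $\epsilon\in(0,1)$, then for all $k\ge1$, $\min_{0\le i\le k}\mathbb{E}[\|\mathcal H(x_i)-x_i\|_2^2]\le\frac{D^2+2A\epsilon^2}{(1-\epsilon)\epsilon}\frac{1}{\log(k+1)}$.
   Context: $\|\cdot\|_2$ is the Euclidean norm on $\mathbb{R}^d$. *)

(* Defs.v *)
From HB Require Import structures.
From mathcomp Require Import all_boot all_order all_algebra.
From mathcomp Require Import all_classical all_reals all_analysis.
Set Implicit Arguments. Unset Strict Implicit. Unset Printing Implicit Defensive.
Import Order.TTheory GRing.Theory Num.Theory.
Local Open Scope classical_set_scope.
Local Open Scope ring_scope.

Definition norm2 {R : realType} {d : nat} (v : 'rV[R]_d) : R :=
  Num.sqrt (\sum_(j < d) v ord0 j ^+ 2).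

Definition fixpts {R : realType} {d : nat} (H : 'rV[R]_d -> 'rV[R]_d) : set 'rV[R]_d :=
  [set x | H x = x].

Definition dist_set {R : realType} {d : nat} (x : 'rV[R]_d) (X : set 'rV[R]_d) : R :=
  inf [set norm2 (x - y) | y in X].

Definition bounded2 {R : realType} {d : nat} (X : set 'rV[R]_d) : Prop :=
  exists M : R, forall y, X y -> norm2 y <= M.

(* F_k = sigma(x_0, w_0, ..., x_{k-1}, w_{k-1}, x_k): generated by the
   preimages of Borel sets under the coordinates of these random vectors
   (the Borel sigma-algebra of R^d is generated by the coordinates). *)
Definition filt {dT : measure_display} {T : measurableType dT} {R : realType} {d : nat}
  (x w : nat -> T -> 'rV[R]_d) (k : nat) : set (set T) :=
  <<s [set B | exists (i : nat) (j : 'I_d) (U : set R), measurable U /\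
        ((i <= k)%N /\ B = (fun t => x i t ord0 j) @^-1` U \/
         (i < k)%N /\ B = (fun t => w i t ord0 j) @^-1` U)] >>.

(* Main.v *)
(* For a fixed point z, convexity of the squared norm and nonexpansiveness give
   E[|x_{k+1} - z|^2 | F_k] <= |x_k - z|^2 - eps_k (1 - eps_k) |H x_k - x_k|^2 + A eps_k^2.
   Taking expectations and telescoping yields the finite-time bounds; in (c) and
   (d) only the indices i < k are summed, which is what produces the stated constants.
   For (a), |x_k - z|^2 plus the tail of A sum eps_j^2 is eventually a nonnegative
   supermartingale, so no convergence theorem is needed beyond the maximal
   inequality eta P(B and sup_{k >= n} Z_k >= eta) <= int_B Z_n for B in F_n.
   It makes the iterates almost surely bounded, and with liminf |H x_k - x_k| = 0
   they almost surely come within g of some point y_j of a finite g-net of the fixed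
   points; restarting the maximal inequality, centred at y_j, at that first visit
   bounds P(dist(x_k, X) >= e infinitely often) by 5 g^2 / e^2 for every g > 0. *)
Require Import Defs.
From HB Require Import structures.
From mathcomp Require Import all_boot all_order all_algebra.
From mathcomp Require Import all_classical all_reals all_analysis.
From mathcomp Require Import measurable_realfun ring lra.
Set Implicit Arguments.
Unset Strict Implicit.
Unset Printing Implicit Defensive.
Import Order.TTheory GRing.Theory Num.Theory.
Import numFieldNormedType.Exports.
Local Open Scope classical_set_scope.
Local Open Scope ring_scope.

(** * Euclidean norm *)

Section Euclid.
Context {R : realType} {d : nat}.
Implicit Types u v : 'rV[R]_d.

Definition dot u v : R := \sum_(j < d) u ord0 j * v ord0 j.

Lemma norm2_sq v : norm2 v ^+ 2 = \sum_(j < d) v ord0 j ^+ 2.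
Proof. by rewrite sqr_sqrtr// sumr_ge0// => j _; rewrite sqr_ge0. Qed.

Lemma norm2_ge0 v : 0 <= norm2 v.
Proof. exact: sqrtr_ge0. Qed.

Lemma norm2_sqD u v : norm2 (u + v) ^+ 2 = norm2 u ^+ 2 + 2 * dot u v + norm2 v ^+ 2.
Proof.
rewrite !norm2_sq mulr_sumr -!big_split/=; apply: eq_bigr => j _.
by rewrite mxE; ring.
Qed.

Lemma norm2_sqZ a u : norm2 (a *: u) ^+ 2 = a ^+ 2 * norm2 u ^+ 2.
Proof.
by rewrite !norm2_sq mulr_sumr; apply: eq_bigr => j _; rewrite mxE exprMn.
Qed.

Lemma norm2N u : norm2 (- u) = norm2 u.
Proof. by congr Num.sqrt; apply: eq_bigr => j _; rewrite mxE sqrrN. Qed.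

Lemma norm2_distC u v : norm2 (u - v) = norm2 (v - u).
Proof. by rewrite -norm2N opprB. Qed.

Lemma norm2_0 : norm2 (0 : 'rV[R]_d) = 0.
Proof. by rewrite /norm2 big1 ?sqrtr0// => j _; rewrite mxE expr0n. Qed.

Lemma dotZr a u v : dot u (a *: v) = a * dot u v.
Proof. by rewrite mulr_sumr; apply: eq_bigr => j _; rewrite mxE mulrCA. Qed.

Lemma dotZl a u v : dot (a *: u) v = a * dot u v.
Proof. by rewrite mulr_sumr; apply: eq_bigr => j _; rewrite mxE mulrA. Qed.

Lemma norm_coord_le v j : `|v ord0 j| <= norm2 v.
Proof.
rewrite -(ler_pXn2r (_ : 0 < 2)%N) ?nnegrE ?norm2_ge0// norm2_sq.
by rewrite real_normK ?num_real// (bigD1 j)//= lerDl sumr_ge0// => i _; rewrite sqr_ge0.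
Qed.

Lemma norm2_eq0 v : norm2 v = 0 -> v = 0.
Proof.
move=> v0; apply/rowP => j; apply/eqP; rewrite mxE -normr_eq0 eq_le normr_ge0 andbT.
by rewrite -v0 norm_coord_le.
Qed.

(** Cauchy-Schwarz: expand the nonnegative square of [norm2 v *: u - norm2 u *: v] and divide by the
    product of the norms; zero vectors are treated apart. *)
Lemma dot_le u v : dot u v <= norm2 u * norm2 v.
Proof.
have [/norm2_eq0 ->|u0] := eqVneq (norm2 u) 0.
  by rewrite norm2_0 mul0r /dot big1// => j _; rewrite mxE mul0r.
have [/norm2_eq0 ->|v0] := eqVneq (norm2 v) 0.
  by rewrite norm2_0 mulr0 /dot big1// => j _; rewrite mxE mulr0.
have ugt : 0 < norm2 u by rewrite lt_neqAle eq_sym u0 norm2_ge0.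
have vgt : 0 < norm2 v by rewrite lt_neqAle eq_sym v0 norm2_ge0.
have : 0 <= norm2 (norm2 v *: u + (- norm2 u) *: v) ^+ 2 by rewrite sqr_ge0.
rewrite norm2_sqD !norm2_sqZ dotZl dotZr => h.
rewrite -(ler_pM2l (mulr_gt0 ugt vgt)); nra.
Qed.

Lemma norm2_triangle u v : norm2 (u + v) <= norm2 u + norm2 v.
Proof.
rewrite -(ler_pXn2r (_ : 0 < 2)%N) ?nnegrE ?addr_ge0 ?norm2_ge0//.
by rewrite norm2_sqD; have := dot_le u v; nra.
Qed.

Lemma norm2_triangle_mid m u v : norm2 (u - v) <= norm2 (u - m) + norm2 (m - v).
Proof. by rewrite -{1}(subrK m u) -addrA norm2_triangle. Qed.

(** [|v|] is the maximum norm, which carries the topology of row vectors. This comparison and the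
    next transfer compactness to [norm2]; a crude constant is enough. *)
Lemma normr_le_norm2 v : `|v| <= norm2 v.
Proof.
rewrite [leLHS]/Num.norm/= mx_normrE; apply/bigmax_leP; split; first exact: norm2_ge0.
by move=> [i j] _ /=; rewrite (ord1 i) norm_coord_le.
Qed.

Lemma norm2_le_normr v : norm2 v <= d%:R * `|v|.
Proof.
have h j : `|v ord0 j| <= `|v|.
  by rewrite [leRHS]/Num.norm/= mx_normrE; apply/bigmax_geP; right; exists (ord0, j).
rewrite -(ler_pXn2r (_ : 0 < 2)%N) ?nnegrE ?norm2_ge0 ?mulr_ge0//.
rewrite norm2_sq (@le_trans _ _ (\sum_(j < d) `|v| ^+ 2))//.
  by apply: ler_sum => j _; rewrite -real_normK ?num_real// lerXn2r ?nnegrE.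
rewrite sumr_const card_ord -(mulr_natl (_ ^+ 2)) exprMn ler_wpM2r ?sqr_ge0//.
by rewrite -natrX ler_nat; case: (d) => // n; rewrite expnS expn1 leq_pmulr.
Qed.

(** * Nonexpansive maps, cluster points and nets of fixed points *)

Definition nonexp (H : 'rV[R]_d -> 'rV[R]_d) :=
  forall u v, norm2 (H u - H v) <= norm2 (u - v).

Lemma norm2_convex a u v : norm2 ((1 - a) *: u + a *: v) ^+ 2 =
  (1 - a) * norm2 u ^+ 2 + a * norm2 v ^+ 2 - a * (1 - a) * norm2 (v - u) ^+ 2.
Proof.
rewrite !norm2_sq !mulr_sumr -!big_split/= -sumrB; apply: eq_bigr => j _.
by rewrite !mxE; ring.
Qed.

(** Krasnoselskii-Mann estimate: the vector is the convex-type combination of [x - z] and [H x - z]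
    with weights [1 - e] and [e], and [norm2 (H x - z) <= norm2 (x - z)] because [z] is fixed. *)
Lemma norm2_KM H x z e : nonexp H -> H z = z -> 0 < e ->
  norm2 ((x - z) + e *: (H x - x)) ^+ 2 <=
    norm2 (x - z) ^+ 2 - e * (1 - e) * norm2 (H x - x) ^+ 2.
Proof.
move=> Hn Hz e0.
have -> : (x - z) + e *: (H x - x) = (1 - e) *: (x - z) + e *: (H x - z).
  by apply/rowP => j; rewrite !mxE; ring.
rewrite norm2_convex.
have -> : H x - z - (x - z) = H x - x by rewrite opprB addrA subrK.
have : norm2 (H x - z) ^+ 2 <= norm2 (x - z) ^+ 2.
  by rewrite lerXn2r ?nnegrE ?norm2_ge0// -{1}Hz Hn.
by nra.
Qed.

(** Bolzano-Weierstrass, in cluster-point form: the sequence stays in a closed ball of the maximum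
    norm, which is compact. *)
Lemma norm2_seq_cvg (z : nat -> 'rV[R]_d) M :
  (forall n, norm2 (z n) <= M) ->
  exists p, forall e, 0 < e -> forall N : nat, exists n, (N <= n)%N /\ norm2 (z n - p) < e.
Proof.
move=> zM.
have cK : compact [set v : 'rV[R]_d | `|v| <= M].
  apply: bounded_closed_compact.
    exists M; split; first exact: num_real.
    by move=> y My v /= vM; rewrite (le_trans vM)// ltW.
  rewrite (_ : [set v | _] = (fun v => `|v|) @^-1` [set y | y <= M])//.
  by apply: closed_comp; [move=> ? _; exact: norm_continuous|exact: closed_le].
have zK : (z @ \oo) [set v : 'rV[R]_d | `|v| <= M].
  by exists 0%N => // n _ /=; rewrite (le_trans (normr_le_norm2 _)).
have [p [_ clp]] := cK (z @ \oo) _ zK; exists p => e e0 N.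
(* Dividing by [d + 1] rather than [d] keeps the radius meaningful in dimension 0. *)
have d0 : 0 < d%:R + 1 :> R by rewrite ltr_wpDl.
have [v [[n /= Nn <-] pv]] := clp [set z n | n in [set n | (N <= n)%N]]
   (ball p (e / (d%:R + 1))) (ltac:(exists N => // n /= ?; exists n => //)) (nbhsx_ballx _ (e/(d%:R+1)) (divr_gt0 e0 d0)).
exists n; split => //; rewrite norm2_distC (le_lt_trans (norm2_le_normr _))//.
move: pv; rewrite -ball_normE /= => pv.
apply: (@le_lt_trans _ _ ((d%:R + 1) * `|p - z n|)).
  by rewrite ler_wpM2r// lerDl.
by rewrite mulrC -ltr_pdivlMr.
Qed.

(** Choose indices [f i >= i] along which the residual is below [1 / (i + 1)]. A cluster point [p]
    of that subsequence is fixed, since [norm2 (H p - p)] splits into three terms, each below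
    [e / 3]. *)
Lemma fix_cluster H (z : nat -> 'rV[R]_d) M : nonexp H ->
  (forall n, norm2 (z n) <= M) ->
  (forall g, 0 < g -> forall N : nat, exists n, (N <= n)%N /\ norm2 (H (z n) - z n) < g) ->
  exists2 p, H p = p & forall e, 0 < e -> forall N : nat, exists n, (N <= n)%N /\ norm2 (z n - p) < e.
Proof.
move=> Hn zM zH.
have /choice[f fP] : forall i : nat, exists n : nat, (i <= n)%N /\ norm2 (H (z n) - z n) < i.+1%:R^-1.
  by move=> i; apply: zH; rewrite invr_gt0.
have [p pP] := @norm2_seq_cvg (z \o f) M (fun n => zM _).
exists p; last first.
  move=> e e0 N; have [n [Nn h]] := pP e e0 N; exists (f n); split => //.
  by rewrite (leq_trans Nn)//; have [] := fP n.
apply/eqP; rewrite -subr_eq0; apply/eqP/norm2_eq0/eqP; rewrite eq_le norm2_ge0 andbT.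
apply/ler_addgt0Pl => e e0; rewrite addr0.
have e3 : 0 < e / 3 by rewrite divr_gt0.
have [N NP] : exists N : nat, forall n, (N <= n)%N -> n.+1%:R^-1 < e / 3.
  have [N _ h] := near_infty_natSinv_lt (PosNum e3).
  by exists N => n Nn; exact: (h n Nn).
have [n [Nn h]] := pP _ e3 N.
have [_ fn] := fP n.
have h1 := norm2_triangle_mid (H (z (f n))) (H p) p.
have h2 := norm2_triangle_mid (z (f n)) (H (z (f n))) p.
have h3 := Hn p (z (f n)).
have h4 := NP n Nn.
rewrite (norm2_distC p) in h3.
rewrite /= in h.
have zn := lt_trans fn h4.
apply: (le_trans h1); apply: (le_trans (lerD h3 h2)); apply: ltW.
have -> : e = e / 3 + (e / 3 + e / 3) by field.
by rewrite ltrD// ltrD.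
Qed.

(** Total boundedness: without a finite net, fixed points could be picked greedily at mutual
    distance at least [e], and a bounded sequence of that kind has no cluster point. *)
Lemma fixpts_net H e : bounded2 (fixpts H) -> nonexp H -> fixpts H !=set0 -> 0 < e ->
  exists r (y : nat -> 'rV[R]_d), [/\ (0 < r)%N, forall j, H (y j) = y j &
    forall p, H p = p -> exists j, (j < r)%N /\ norm2 (p - y j) < e].
Proof.
move=> [M XM] Hn [y0 Hy0] e0.
apply: contrapT => nex.
have step (s : seq 'rV[R]_d) : (forall y, y \in s -> H y = y) ->
    exists p, H p = p /\ forall y, y \in s -> e <= norm2 (p - y).
  move=> sX; apply: contrapT => np; apply: nex.
  (* Putting [y0] in front makes [r] positive, and using it as default makes every [y j] a fixed
     point, even for [j >= r]. *)
  exists (size (y0 :: s)), (nth y0 (y0 :: s)); split => //.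
    move=> j; case: (ltnP j (size (y0 :: s))) => [|js]; last by rewrite nth_default.
    by move=> /(mem_nth y0); rewrite inE => /predU1P[->|/sX].
  move=> p Hp; apply: contrapT => nj; apply: np; exists p; split => // y ys.
  rewrite leNgt; apply/negP => pye; apply: nj; exists (index y s).+1.
  by rewrite /= ltnS index_mem ys nth_index.
have /choice[f fP] : forall s : seq 'rV[R]_d, exists p, (forall y, y \in s -> H y = y) ->
    H p = p /\ forall y, y \in s -> e <= norm2 (p - y).
  move=> s; have [/step[p ?]|ns] := pselect (forall y, y \in s -> H y = y); first by exists p.
  by exists y0.
(* [S n] lists the points chosen before stage [n], and [f] returns a fixed point far from all of
   them. *)
pose S := fix S n := if n is m.+1 then f (S m) :: S m else [::].
have SX n : forall y, y \in S n -> H y = y.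
  elim: n => [|n ih] y //=; rewrite inE => /predU1P[->|/ih//].
  by have [] := fP _ ih.
pose z n := f (S n).
have zX n : H (z n) = z n by have [] := fP _ (SX n).
have zS n m : (n < m)%N -> z n \in S m.
  elim: m => // m ih; rewrite ltnS leq_eqVlt => /predU1P[->|/ih]; rewrite /= inE ?eqxx// => ->.
  by rewrite orbT.
have zsep n m : (n < m)%N -> e <= norm2 (z m - z n).
  by move=> nm; have [_] := fP _ (SX m); apply; exact: zS.
have [p pP] := @norm2_seq_cvg z M (fun n => XM _ (zX n)).
have e2 : 0 < e / 2 by rewrite divr_gt0.
have [n [_ n1]] := pP _ e2 0%N.
have [m [nm m1]] := pP _ e2 n.+1.
have := zsep _ _ nm; have := norm2_triangle_mid p (z m) (z n); rewrite (norm2_distC p) => h1 h2.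
lra.
Qed.

(** * Distance to a set *)

Lemma dist_set_le (x y : 'rV[R]_d) X : X y -> dist_set x X <= norm2 (x - y).
Proof.
move=> Xy; apply: ge_inf; last by exists y.
by exists 0 => _ [z _ <-]; exact: norm2_ge0.
Qed.

Lemma dist_set_ge0 (x : 'rV[R]_d) X : 0 <= dist_set x X.
Proof.
have [->|/set0P X0] := eqVneq X set0; first by rewrite /dist_set image_set0 inf0.
apply: lb_le_inf; first by case: X0 => y Xy; exists (norm2 (x - y)), y.
by move=> _ [z _ <-]; exact: norm2_ge0.
Qed.

Lemma dist_set_lip (x y : 'rV[R]_d) X : X !=set0 -> dist_set x X - dist_set y X <= norm2 (x - y).
Proof.
move=> [z0 Xz0]; rewrite lerBlDr -lerBlDl; apply: lb_le_inf.
  by exists (norm2 (y - z0)), z0.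
move=> _ [z Xz <-]; rewrite lerBlDl (le_trans (dist_set_le x Xz))//.
exact: norm2_triangle_mid.
Qed.

End Euclid.

(** * Measurability and orthogonality *)

Section Measurability.
Context {dT : measure_display} {T : measurableType dT} {R : realType}.

Lemma measurable_norm2 {d : nat} (f : T -> 'rV[R]_d) (c : 'rV[R]_d) :
  (forall j, measurable_fun setT (fun t => f t ord0 j)) ->
  measurable_fun setT (fun t => norm2 (f t - c)).
Proof.
move=> mf; have ms : measurable_fun setT (@Num.sqrt R).
  by apply: continuous_measurable_fun; exact: sqrt_continuous.
apply: (measurableT_comp ms); apply: measurable_sum => j; apply: measurable_funX.
by under eq_fun do rewrite !mxE; apply: measurable_funB.
Qed.

Lemma rat_dense_norm2 {d : nat} (v : 'rV[R]_d) (e : R) : 0 < e ->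
  exists q : 'rV[rat]_d, norm2 (v - map_mx ratr q) < e.
Proof.
move=> e0.
have d0 : 0 < d%:R + 1 :> R by rewrite ltr_wpDl.
have e1 : 0 < e / (d%:R + 1) by rewrite divr_gt0.
have /choice[q qP] : forall j : 'I_d, exists q : rat, `|v ord0 j - ratr q| < e / (d%:R + 1).
  move=> j; have /rat_in_itvoo[q] : v ord0 j - e / (d%:R + 1) < v ord0 j + e / (d%:R + 1).
    by rewrite ltrD2l gt0_cp.
  by rewrite inE /= => /itvP h; exists q; rewrite distrC ltr_distl !h.
exists (\row_j q j); rewrite (le_lt_trans (norm2_le_normr _))//.
have : `|v - map_mx ratr (\row_j q j)| < e / (d%:R + 1).
  rewrite [ltLHS]/Num.norm/= mx_normrE; apply/bigmax_ltP; split => //.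
  by move=> [i j] _ /=; rewrite (ord1 i) !mxE.
rewrite ltr_pdivlMr// mulrC => h; rewrite (le_lt_trans _ h)// ler_wpM2r//.
by rewrite lerDl.
Qed.

(* g o f < c iff g q + |f - q| < c for some rational point q, a countable union. *)
Lemma lipschitz_measurable {d : nat} (f : T -> 'rV[R]_d) (g : 'rV[R]_d -> R) :
  (forall u v, g u - g v <= norm2 (u - v)) ->
  (forall j, measurable_fun setT (fun t => f t ord0 j)) ->
  measurable_fun setT (fun t => g (f t)).
Proof.
move=> gL mf mD; apply: (measurability _ (RGenInftyO.measurableE R)) => //.
move=> _ [_ [c ->] <-]; rewrite setTI.
rewrite (_ : _ @^-1` _ = \bigcup_(q : 'rV[rat]_d)
    [set t | norm2 (f t - map_mx ratr q) < c - g (map_mx ratr q)]).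
  apply: countable_bigcupT_measurable; first exact: countableP.
  move=> q; have := measurable_norm2 (map_mx ratr q) mf measurableT.
  move=> /(_ `]-oo, c - g (map_mx ratr q)[%classic (measurable_itv _)).
  by rewrite setTI set_itvNyo.
apply/seteqP; split => t /=; rewrite in_itv/=.
  move=> gc; have [|q qP] := @rat_dense_norm2 d (f t) ((c - g (f t)) / 2).
    by rewrite divr_gt0// subr_gt0.
  exists q => //=; have := gL (map_mx ratr q) (f t); rewrite norm2_distC => h.
  by move: qP h; set a := norm2 _; set b := g _; set u := g _ => qP h; lra.
by move=> [q _ /=]; have := gL (f t) (map_mx ratr q); lra.
Qed.

End Measurability.

Section Orthogonality.
Context {dT : measure_display} {T : measurableType dT} {R : realType}.
Variable (P : probability T R) (G : set (set T)).
Local Notation TG := (g_sigma_algebraType G).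

(** [W] integrates to zero over every set of the sub-sigma-algebra, hence against simple functions
    of [g]; dominated convergence, with dominating function [|W g|], passes to [g] itself. *)
Lemma integral_mul_ge0_eq0 (W g : T -> R) :
  <<s G >> `<=` measurable ->
  (forall B, <<s G >> B -> (\int[P]_(t in B) (W t)%:E = 0)%E) ->
  P.-integrable setT (EFin \o W) ->
  measurable_fun (setT : set TG) (g : TG -> R) -> (forall t, 0 <= g t) ->
  P.-integrable setT (EFin \o (W \* g)) ->
  (\int[P]_t (W t * g t)%:E = 0)%E.
Proof.
move=> Gm W0 iW mg g0 iWg.
have mW : measurable_fun setT W by exact/measurable_EFinP/(measurable_int _ iW).
have mgG U : measurable U -> <<s G >> (g @^-1` U).
  by move=> mU; have := mg measurableT U mU; rewrite setTI.
(* The approximation is built on the real line and then composed with [g], so that its level sets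
   pull back to sets of the sub-sigma-algebra. Truncation at 0 makes [h] nonnegative everywhere
   without changing it on the values of [g]. *)
pose h := fun y : R => (Num.max y 0)%:E.
have mh : measurable_fun setT h.
  apply/measurable_EFinP/measurable_maxr => //.
pose a n : R -> R := approx setT h n.
have h0 (y : R) : setT y -> (0 <= h y)%E by rewrite lee_fin le_max lexx orbT.
have hg t : h (g t) = (g t)%:E by rewrite /h max_l.
have a_le n t : a n (g t) <= g t by rewrite -lee_fin -hg le_approx.
have a_ge0 n y : 0 <= a n y.
  rewrite /a /approx !indicE addr_ge0 ?mulr_ge0 ?ler0n//; apply: sumr_ge0 => k _.
  by rewrite indicE mulr_ge0 ?ler0n// divr_ge0 ?ler0n// exprn_ge0.
have mdy n k : measurable (dyadic_approx setT h n k).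
  rewrite /dyadic_approx; case: ifPn => // _.
  rewrite (_ : [set x | _] = h @^-1` (EFin @` [set` dyadic_itv R n k])); last first.
    by apply/seteqP; split => y /=; rewrite inE.
  by apply: mh => //; apply/measurable_image_EFin; exact: measurable_itv.
have mint n : measurable (integer_approx setT h n) by exact: emeasurable_fun_c_infty.
have ma n : measurable_fun setT (a n).
  apply: measurable_funD; last by apply: measurable_funM => //; exact: measurable_indic.
  by apply: measurable_sum => k; apply: measurable_funM => //; exact: measurable_indic.
have mgT : measurable_fun setT g.
  by move=> _ U mU; rewrite setTI; exact: (Gm _ (mgG U mU)).
have iWI B : <<s G >> B -> P.-integrable setT (fun t => (W t * \1_B t)%:E).
  move=> GB; apply: le_integrable iW => //.
    apply/measurable_EFinP/measurable_funM => //; apply: measurable_indic; exact: Gm.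
  move=> t _ /=; rewrite lee_fin normrM ler_piMr// indicE.
  by case: (_ \in _); rewrite ?normr1 ?normr0.
have WI B : <<s G >> B -> (\int[P]_t (W t * \1_B t)%:E = 0)%E.
  move=> GB; rewrite -[RHS](W0 _ GB) [RHS]integral_mkcond.
  apply: eq_integral => t _; rewrite patchE indicE.
  by case: (_ \in _); rewrite ?mulr1 ?mulr0.
have Wa n : (\int[P]_t (W t * a n (g t))%:E = 0)%E.
  transitivity (\int[P]_t (\sum_(k < n * 2 ^ n)
      ((k%:R * 2 ^- n)%:E * (W t * \1_(g @^-1` dyadic_approx setT h n k) t)%:E)
      + n%:R%:E * (W t * \1_(g @^-1` integer_approx setT h n) t)%:E))%E.
    apply: eq_integral => t _; rewrite /a /approx mulrDr EFinD; congr (_ + _)%E.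
      rewrite mulr_sumr -sumEFin; apply: eq_bigr => k _.
      by rewrite -EFinM mulrCA !indicE.
    by rewrite -EFinM mulrCA !indicE.
  have iA k := iWI _ (mgG _ (mdy n k)); have iB := iWI _ (mgG _ (mint n)).
  have iA' k := integrableZl measurableT (k%:R * 2 ^- n) (iA k).
  have WA k := WI _ (mgG _ (mdy n k)); have WB := WI _ (mgG _ (mint n)).
  rewrite integralD//; last 2 first.
    by apply: integrable_sum => // k _; exact: iA'.
    exact: integrableZl.
  rewrite integral_sum//.
  rewrite -[RHS]adde0; congr (_ + _)%E; last by rewrite integralZl// WB mule0.
  by apply: big1 => k _; rewrite integralZl// WA mule0.
have WaE : (fun n => \int[P]_t (W t * a n (g t))%:E)%E = cst 0%E by apply/funext => n; exact: Wa.
suff /cvg_lim <- : (\int[P]_t (W t * a n (g t))%:E)%E @[n --> \oo] --> (\int[P]_t (W t * g t)%:E)%E.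
- by rewrite WaE lim_cst.
- exact: ereal_hausdorff.
apply: (@dominated_cvg _ T R P setT measurableT (fun n t => (W t * a n (g t))%:E)
  (fun t => (W t * g t)%:E) (fun t => `|W t * g t|%:E)) => //.
- move=> n; apply/measurable_EFinP/measurable_funM => //.
  exact: (measurableT_comp (ma n)).
- move=> t _; apply/cvg_EFin; first by near=> n.
  apply: cvgMr.
  by have := @cvg_approx _ _ _ setT h (g t) h0 I (ltry _); rewrite hg.
- exact: integrable_norm iWg.
- move=> n t _; rewrite lee_fin !normrM ler_wpM2l// !ger0_norm//.
Unshelve. all: by end_near. Qed.

(** Reduction to the nonnegative case: [g] is split into positive and negative parts, each
    multiplied by the indicator of [B]. *)
Lemma integral_mul_eq0 (W g : T -> R) (B : set T) :
  <<s G >> `<=` measurable ->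
  (forall B, <<s G >> B -> (\int[P]_(t in B) (W t)%:E = 0)%E) ->
  P.-integrable setT (EFin \o W) ->
  measurable_fun (setT : set TG) (g : TG -> R) ->
  P.-integrable setT (EFin \o (W \* g)) -> <<s G >> B ->
  (\int[P]_(t in B) (W t * g t)%:E = 0)%E.
Proof.
move=> Gm W0 iW mg iWg GB.
have mW : measurable_fun setT W by exact/measurable_EFinP/(measurable_int _ iW).
have mgT : measurable_fun setT g.
  by move=> _ U mU; rewrite setTI; apply: Gm; have := mg measurableT U mU; rewrite setTI.
pose gp := fun t => Num.max (g t) 0 * \1_B t : R.
pose gn := fun t => Num.max (- g t) 0 * \1_B t : R.
have mB : measurable_fun (setT : set TG) (\1_B : TG -> R) by apply: measurable_indic.
have mBT : measurable_fun setT (\1_B : T -> R) by apply: measurable_indic; exact: Gm.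
have mp : measurable_fun (setT : set TG) (gp : TG -> R).
  by apply: measurable_funM => //; apply: measurable_maxr.
have mn : measurable_fun (setT : set TG) (gn : TG -> R).
  apply: measurable_funM => //; apply: measurable_maxr => //.
  exact: (measurableT_comp (@oppr_measurable R setT)).
have mpT : measurable_fun setT gp.
  by apply: measurable_funM => //; apply: measurable_maxr.
have mnT : measurable_fun setT gn.
  apply: measurable_funM => //; apply: measurable_maxr => //.
  exact: (measurableT_comp (@oppr_measurable R setT)).
have le1 (u : R) t : `|u * \1_B t| <= `|u|.
  rewrite normrM ler_piMr// indicE.
  by case: (_ \in _); rewrite ?normr1 ?normr0.
have iWp : P.-integrable setT (EFin \o (W \* gp)).
  apply: le_integrable iWg => //; first exact/measurable_EFinP/measurable_funM.
  move=> t _ /=; rewrite lee_fin (normrM _ (gp t)) (normrM _ (g t)) ler_wpM2l// (le_trans (le1 _ _))//.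
  by rewrite /Num.max; case: ifPn => // _; rewrite normr0.
have iWn : P.-integrable setT (EFin \o (W \* gn)).
  apply: le_integrable iWg => //; first exact/measurable_EFinP/measurable_funM.
  move=> t _ /=; rewrite lee_fin (normrM _ (gn t)) (normrM _ (g t)) ler_wpM2l// (le_trans (le1 _ _))//.
  by rewrite /Num.max; case: ifPn => // _; rewrite ?normr0 ?normrN.
rewrite integral_mkcond.
transitivity (\int[P]_t ((W t * gp t)%:E - (W t * gn t)%:E))%E.
  apply: eq_integral => t _; rewrite patchE -EFinB -mulrBr /gp /gn -mulrBl indicE.
  case: (_ \in _); rewrite ?mulr1 ?mulr0//; congr (_ * _)%:E.
  by rewrite /Num.max; do 2 case: ifPn; rewrite -?leNgt; lra.
rewrite integralB// !integral_mul_ge0_eq0 ?sube0//.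
- by move=> t; rewrite mulr_ge0// le_max lexx orbT.
- by move=> t; rewrite mulr_ge0// le_max lexx orbT.
Qed.

End Orthogonality.

(** * Integration and filtration *)

Section RealIntegrable.
Context {dT : measure_display} {T : measurableType dT} {R : realType}.
Variable P : probability T R.
Implicit Types f g : T -> R.

Definition rintegrable f := P.-integrable setT (EFin \o f).

Lemma rintegrableD f g : rintegrable f -> rintegrable g -> rintegrable (fun t => f t + g t).
Proof. by move=> If Ig; exact: integrableD If Ig. Qed.

Lemma rintegrableZ a f : rintegrable f -> rintegrable (fun t => a * f t).
Proof. by move=> If; exact: (integrableZl measurableT a If). Qed.

Lemma rintegrable_cst a : rintegrable (cst a).
Proof. exact: finite_measure_integrable_cst. Qed.

Lemma rintegrable_le f g : measurable_fun setT f -> (forall t, `|f t| <= g t) ->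
  rintegrable g -> rintegrable f.
Proof.
move=> mf fg; apply: le_integrable => //; first exact/measurable_EFinP.
by move=> t _; rewrite lee_fin (le_trans (fg t))// ler_norm.
Qed.

Lemma rintegrable_sum (I : Type) (s : seq I) (f : I -> T -> R) :
  (forall i, rintegrable (f i)) -> rintegrable (fun t => \sum_(i <- s) f i t).
Proof.
move=> If; rewrite /rintegrable (_ : EFin \o _ = fun t => (\sum_(i <- s) (f i t)%:E)%E).
  by apply: integrable_sum => // i _; exact: If.
by apply/funext => t; rewrite /= sumEFin.
Qed.

Lemma rintegrableS f B : measurable B -> rintegrable f -> P.-integrable B (EFin \o f).
Proof. by move=> mB; apply: integrableS. Qed.

Lemma RintegralE f B : measurable B -> rintegrable f ->
  (\int[P]_(t in B) (f t)%:E)%E = (\int[P]_(t in B) f t)%:E.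
Proof.
move=> mB If; rewrite /Rintegral fineK//.
by apply: integrable_fin_num => //; exact: rintegrableS.
Qed.

Lemma Rintegral_subset f (B C : set T) : measurable B -> measurable C -> B `<=` C ->
  rintegrable f -> (forall t, 0 <= f t) ->
  \int[P]_(t in B) f t <= \int[P]_(t in C) f t.
Proof.
move=> mB mC BC If f0; rewrite -lee_fin -!RintegralE//.
apply: ge0_subset_integral => //; last by move=> t _; rewrite lee_fin.
exact: (measurable_int P (rintegrableS mC If)).
Qed.

Lemma markov_on f (B : set T) (c : R) : measurable B ->
  rintegrable f -> (forall t, B t -> c <= f t) ->
  c * fine (P B) <= \int[P]_(t in B) f t.
Proof.
move=> mB If cf; rewrite -Rintegral_cst//; apply: le_Rintegral => //.
- by apply: finite_measure_integrable_cst.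
- exact: rintegrableS.
Qed.

(** On the event each [r i] with [i >= m] is at least [c], so its integral is at least [c] times the
    probability of the event; a positive probability would make the weighted sums exceed [C]. *)
Lemma null_of_divergence (r : nat -> T -> R) (a : nat -> R) (m : nat) (c C : R) :
  (forall n, rintegrable (r n)) -> (forall n t, 0 <= r n t) ->
  (forall n, 0 <= a n) -> 0 < c ->
  (forall M, exists n, M < \sum_(m <= i < n) a i) ->
  (forall n, \sum_(m <= i < n) a i * \int[P]_t r i t <= C) ->
  measurable [set t | forall n, (m <= n)%N -> c <= r n t] /\
  P [set t | forall n, (m <= n)%N -> c <= r n t] = 0%E.
Proof.
move=> Ir r0 a0 c0 adiv aC; set S := [set t | _].
have mS : measurable S.
  rewrite (_ : S = \bigcap_n [set t | (m <= n)%N -> c <= r n t]); last first.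
    by apply/seteqP; split => t h n; [move=> _|]; exact: h.
  apply: bigcapT_measurable => n; case: (leqP m n) => mn; last first.
    by rewrite (_ : [set t | _] = setT)//; apply/seteqP; split.
  have mr : measurable_fun setT (r n) by exact/measurable_EFinP/(measurable_int _ (Ir n)).
  have := mr measurableT `[c, +oo[%classic (measurable_itv _).
  rewrite setTI set_itvcy; congr measurable.
  by apply/seteqP; split => t /= h //; exact: h.
split => //; apply/eqP; apply: contrapT => /negP pS.
have p0 : 0 < fine (P S) by rewrite fine_gt0// lt0e pS measure_ge0/= ltey_eq fin_num_measure.
have [n nP] := adiv (C / (c * fine (P S))).
have gp0 : 0 < c * fine (P S) by rewrite mulr_gt0.
move: nP; rewrite ltr_pdivrMr// ltNge => /negP; apply.
apply: le_trans (aC n); rewrite mulr_suml !big_nat; apply: ler_sum => i /andP[mi _].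
rewrite ler_wpM2l//; apply: (@le_trans _ _ (\int[P]_(t in S) r i t)).
  by apply: markov_on => // t; apply.
exact: Rintegral_subset.
Qed.

End RealIntegrable.

Section Filtration.
Context {dT : measure_display} {T : measurableType dT} {R : realType} {d : nat}.
Variables (x w : nat -> T -> 'rV[R]_d).

(** The generating family of [filt x w k], named so that [g_sigma_algebraType] can turn it into a
    measurable space on which adaptedness is expressed. *)
Definition filt_gen (k : nat) : set (set T) :=
  [set B | exists (i : nat) (j : 'I_d) (U : set R), measurable U /\
        ((i <= k)%N /\ B = (fun t => x i t ord0 j) @^-1` U \/
         (i < k)%N /\ B = (fun t => w i t ord0 j) @^-1` U)].

Lemma filt_sub k l : (k <= l)%N -> filt x w k `<=` filt x w l.
Proof.
move=> kl; apply: sub_sigma_algebra2 => B [i [j [U [mU h]]]].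
exists i, j, U; split => //; case: h => -[ik ->]; [left|right]; split => //.
  exact: leq_trans kl.
exact: leq_trans kl.
Qed.

Lemma filt_measurable_coord k (j : 'I_d) :
  measurable_fun (setT : set (g_sigma_algebraType (filt_gen k)))
    (fun t : g_sigma_algebraType (filt_gen k) => x k t ord0 j).
Proof.
move=> _ U mU; rewrite setTI; apply: sub_sigma_algebra.
by exists k, j, U; split => //; left.
Qed.

Lemma filt_measurable k :
  (forall k (j : 'I_d), measurable_fun setT (fun t => x k t ord0 j)) ->
  (forall k (j : 'I_d), measurable_fun setT (fun t => w k t ord0 j)) ->
  filt x w k `<=` measurable.
Proof.
move=> mx mw; apply: smallest_sub; first exact: sigma_algebra_measurable.
move=> B [i [j [U [mU h]]]]; rewrite -[B]setTI.
by case: h => -[_ ->]; [exact: mx|exact: mw].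
Qed.

End Filtration.

(** * Real sequences *)

Section RealSequences.
Context {R : realType}.

Lemma telescope_descent (v a r c : nat -> R) n :
  (forall i, v i.+1 + a i * r i <= v i + c i) ->
  v n + \sum_(0 <= i < n) a i * r i <= v 0%N + \sum_(0 <= i < n) c i.
Proof.
move=> h; elim: n => [|n ih]; first by rewrite !big_geq.
by rewrite !big_nat_recr//=; have := h n; lra.
Qed.

(** If all [r i] with [i < n] exceeded [N / S], their weighted sum would exceed [N], against the
    telescoped inequality. [S] and [N] are free bounds, so that each stepsize rule can insert its
    own estimates. *)
Lemma descent_min (v a r c : nat -> R) n S N :
  (forall i, v i.+1 + a i * r i <= v i + c i) -> (forall i, 0 <= v i) ->
  (forall i, 0 < a i) -> (forall i, 0 <= r i) -> (0 < n)%N ->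
  0 < S -> S <= \sum_(0 <= i < n) a i ->
  v 0%N + \sum_(0 <= i < n) c i <= N ->
  exists2 i, (i < n)%N & r i <= N / S.
Proof.
move=> h v0 a0 r0 n0 S0 Sa cN; apply: contrapT => nex.
have lt i : (0 <= i < n)%N -> a i * (N / S) < a i * r i.
  move=> /andP[_ ni]; rewrite ltr_pM2l// ltNge; apply/negP => ri; apply: nex.
  by exists i.
have := ltr_sum_nat n0 lt; rewrite -mulr_suml ltNge => /negP; apply.
have le := telescope_descent n h.
have arN : \sum_(0 <= i < n) a i * r i <= N.
  by apply: le_trans cN; apply: le_trans le; rewrite lerDr.
have N0 : 0 <= N.
  by apply: le_trans arN; apply: sumr_ge0 => i _; rewrite mulr_ge0// ltW.
rewrite (le_trans arN)// mulrCA -{1}[N]mulr1 ler_wpM2l//.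
by rewrite ler_pdivlMr// mul1r.
Qed.

(** Induction with [ln (1 - 1/(n+2)) <= - 1/(n+2)]. *)
Lemma sum_inv_le_ln n : (0 < n)%N ->
  \sum_(0 <= i < n) (i.+1%:R : R)^-1 <= 1 + ln n%:R.
Proof.
case: n => // n _; elim: n => [|n ih]; first by rewrite big_nat1 invr1 ln1 addr0.
rewrite big_nat_recr//= (le_trans (lerD ih (lexx _)))// -addrA lerD2l.
have n1 : 0 < n.+1%:R :> R by []. have n2 : 0 < n.+2%:R :> R by [].
rewrite -lerBrDl -lerN2 opprB -ln_div ?posrE//.
have -> : n.+1%:R / n.+2%:R = 1 + - (n.+2%:R)^-1 :> R.
  rewrite -(natr1 n.+1) in n2 *; move: n1 n2; set m := n.+1%:R => m0 m1.
  by field; rewrite gt_eqF.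
by apply: le_ln1Dx; rewrite ltrN2 invf_lt1// ltr1n.
Qed.

Lemma ln_le_sum_inv n : ln n.+1%:R <= \sum_(0 <= i < n) (i.+1%:R : R)^-1.
Proof.
elim: n => [|n ih]; first by rewrite big_geq// ln1.
rewrite big_nat_recr//= (le_trans _ (lerD ih (lexx _)))//.
rewrite -lerBlDl -ln_div ?posrE//.
have -> : n.+2%:R / n.+1%:R = 1 + (n.+1%:R)^-1 :> R.
  have : 0 < n.+1%:R :> R by [].
  rewrite -(natr1 n.+1); set m := n.+1%:R => m0.
  by field; rewrite gt_eqF.
by apply: le_ln1Dx; rewrite (lt_trans (ltrN10 _))// invr_gt0.
Qed.

(** For consecutive roots [s <= t], [2 s (t - s) <= (t + s) (t - s) = 1]. *)
Lemma sum_inv_sqrt_ge n :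
  2 * (Num.sqrt n.+1%:R - 1) <= \sum_(0 <= i < n) (Num.sqrt (i.+1%:R : R))^-1.
Proof.
elim: n => [|n ih]; first by rewrite big_geq// sqrtr1 subrr mulr0.
rewrite big_nat_recr//= (le_trans _ (lerD ih (lexx _)))//.
set s := Num.sqrt n.+1%:R; set t := Num.sqrt n.+2%:R.
have s0 : 0 < s by rewrite sqrtr_gt0.
have st : s <= t by rewrite ler_sqrt// ler_nat.
have h : t ^+ 2 = s ^+ 2 + 1 by rewrite !sqr_sqrtr// natr1.
suff : 2 * (t - s) <= s^-1 by lra.
by rewrite -[leRHS]mul1r ler_pdivlMr//; nra.
Qed.

Lemma sum_inv_sq_le n : \sum_(0 <= i < n) (i.+1%:R ^+ 2 : R)^-1 <= 2.
Proof.
case: n => [|n]; first by rewrite big_geq.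
(* The sharper bound [2 - 1/(n+1)] is inductive, since [1/(m+1)^2 <= 1/m - 1/(m+1)]. *)
suff : \sum_(0 <= i < n.+1) (i.+1%:R ^+ 2 : R)^-1 <= 2 - n.+1%:R^-1.
  by move=> h; rewrite (le_trans h)// gerBl.
elim: n => [|n ih]; first by rewrite big_nat1 expr1n invr1; lra.
rewrite big_nat_recr//= (le_trans (lerD ih (lexx _)))// -lerBrDr.
have n1 : 0 < n.+1%:R :> R by [].
have -> : n.+2%:R = n.+1%:R + 1 :> R by rewrite natr1.
move: n1; set m := n.+1%:R => m0.
have m1 : 0 < m + 1 by rewrite addr_gt0.
rewrite -subr_ge0.
have -> : 2 - (m + 1)^-1 - ((m + 1) ^+ 2)^-1 - (2 - m^-1) = (m * (m + 1) ^+ 2)^-1.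
  by field; rewrite !gt_eqF.
by rewrite invr_ge0 mulr_ge0 ?sqr_ge0// ltW.
Qed.

(** [c k] is the tail of the series from index [k], presented through its recursion and its
    smallness. *)
Lemma series_tail (u : nat -> R) : (forall i, 0 <= u i) ->
  (\sum_(k <oo) (u k)%:E < +oo)%E ->
  exists c : nat -> R, [/\ forall k, 0 <= c k, forall k, c k = c k.+1 + u k &
    forall e, 0 < e -> exists K : nat, forall k, (K <= k)%N -> c k <= e].
Proof.
move=> u0 ufin.
have u0' (k : nat) : (0 <= k)%N -> xpredT k -> (0 <= (u k)%:E)%E by move=> _ _; rewrite lee_fin.
have fin : (\sum_(k <oo) (u k)%:E)%E \is a fin_num by rewrite ge0_fin_numE// nneseries_ge0.
set L := fine (\sum_(k <oo) (u k)%:E)%E.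
have LE : (\sum_(k <oo) (u k)%:E)%E = L%:E by rewrite /L fineK.
pose s n := \sum_(0 <= i < n) u i.
exists (fun n => L - s n); split.
- by move=> k; rewrite subr_ge0 -lee_fin -LE -sumEFin; exact: nneseries_lim_ge.
- by move=> k; rewrite /s big_nat_recr//=; lra.
- move=> e e0; have := @is_cvg_nneseries R (fun k => (u k)%:E) xpredT 0 u0'.
  rewrite -/(cvgn _) => cv.
  have : (s n)%:E @[n --> \oo] --> L%:E.
    by rewrite -LE; under eq_fun do rewrite /s -sumEFin.
  move=> /fine_cvgP[_ /cvgrPdist_lt/(_ e e0)[K _ h]]; exists K => k Kk.
  by have := h k Kk; rewrite /= => /ltW; apply: le_trans; exact: ler_norm.
Qed.

Lemma series_divergent (u : nat -> R) : (forall i, 0 <= u i) ->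
  (\sum_(k <oo) (u k)%:E = +oo)%E ->
  forall (m : nat) M, exists n, M < \sum_(m <= i < n) u i.
Proof.
move=> u0 uy m M; apply: contrapT => nex.
have le n : \sum_(m <= i < n) u i <= M.
  by rewrite leNgt; apply/negP => h; apply: nex; exists n.
have : (\sum_(k <oo) (u k)%:E <= (\sum_(0 <= i < m) u i + M)%:E)%E.
  apply: lime_le.
    by apply: is_cvg_nneseries => k _ _; rewrite lee_fin.
  exists m => // n /= mn; rewrite sumEFin lee_fin (big_cat_nat _ mn)//=.
  by rewrite lerD2l.
by rewrite uy leye_eq.
Qed.

End RealSequences.

(** * Maximal inequality *)

Section Maximal.
Context {dT : measure_display} {T : measurableType dT} {R : realType}.
Variables (P : probability T R) (G : nat -> set (set T)).
Hypothesis G_sub : forall n m, (n <= m)%N -> <<s G n >> `<=` <<s G m >>.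
Hypothesis G_measurable : forall n, <<s G n >> `<=` measurable.
Variables (Z : nat -> T -> R) (K : nat).
Hypothesis Z_adapted : forall n,
  measurable_fun (setT : set (g_sigma_algebraType (G n))) (Z n : g_sigma_algebraType (G n) -> R).
Hypothesis Z_ge0 : forall n t, 0 <= Z n t.
Hypothesis Z_int : forall n, rintegrable P (Z n).
Hypothesis Z_super : forall n B, (K <= n)%N -> <<s G n >> B ->
  \int[P]_(t in B) Z n.+1 t <= \int[P]_(t in B) Z n t.

Lemma level_set_adapted n (c : R) : <<s G n >> [set t | c <= Z n t].
Proof.
have := @Z_adapted n measurableT `[c, +oo[%classic (measurable_itv _).
by rewrite setTI set_itvcy.
Qed.

Lemma adaptedI n A B : <<s G n >> A -> <<s G n >> B -> <<s G n >> (A `&` B).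
Proof. exact: (@measurableI _ (g_sigma_algebraType (G n))). Qed.

Lemma adaptedC n A : <<s G n >> A -> <<s G n >> (~` A).
Proof. exact: (@measurableC _ (g_sigma_algebraType (G n))). Qed.

Definition reach (c : R) n N := [set t | exists2 k, (n <= k <= n + N)%N & c <= Z k t].

Lemma reach_measurable c n N : measurable (reach c n N).
Proof.
rewrite (_ : reach c n N = \bigcup_(k in [set k | (n <= k <= n + N)%N]) [set t | c <= Z k t]).
  by apply: bigcup_measurable => k _; exact: (G_measurable (@level_set_adapted k c)).
by apply/seteqP; split => t [k nk ck]; exists k.
Qed.

(** Induction on the horizon [N], for all [n] and [B] at once. Where [Z n >= c] already holds,
    Markov's inequality applies; the rest of [B] is known at time [n], hence at [n + 1], and the
    induction hypothesis followed by the supermartingale inequality bounds it. *)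
Lemma maximal_finite (c : R) N n B : 0 <= c -> (K <= n)%N -> <<s G n >> B ->
  c * fine (P (B `&` reach c n N)) <= \int[P]_(t in B) Z n t.
Proof.
move=> c0; elim: N n B => [|N ih] n B Kn GB.
  have mB := G_measurable GB; have mr := reach_measurable c n 0.
  apply: le_trans (_ : \int[P]_(t in B `&` reach c n 0) Z n t <= _).
    apply: markov_on => //; first exact: measurableI.
    move=> t [_ [k]]; rewrite addn0 => /andP[nk kn] ck.
    by have -> : n = k by apply/eqP; rewrite eqn_leq nk.
  apply: Rintegral_subset => //; first exact: measurableI.
have GL := @level_set_adapted n c.
have GC := adaptedI GB GL; have GD := adaptedI GB (adaptedC GL).
set C := B `&` _ in GC; set D := B `&` _ in GD.
have mC := G_measurable GC; have mD := G_measurable GD.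
have BE : B = C `|` D by rewrite -setIUr setUv setIT.
have mr := reach_measurable c n.+1 N.
rewrite [in leRHS]BE Rintegral_setU//; last 2 first.
  by apply: rintegrableS => //; exact: measurableU.
  by apply/disj_setPS => t [[_ r] [_ nr]].
have h1 : c * fine (P C) <= \int[P]_(t in C) Z n t.
  by apply: markov_on => // t [].
have h2 := le_trans (ih n.+1 D (leqW Kn) (G_sub (leqnSn n) GD)) (Z_super Kn GD).
apply: (le_trans _ (lerD h1 h2)); rewrite -mulrDr ler_wpM2l//.
have mDr := measurableI _ _ mD mr.
rewrite -lee_fin EFinD !fineK ?fin_num_measure//; last first.
  by apply: measurableI; [exact: G_measurable GB|exact: reach_measurable].
apply: (le_trans _ (measureU2 P mC mDr)); apply: le_measure.
- rewrite inE; apply: measurableI; [exact: G_measurable GB|exact: reach_measurable].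
- by rewrite inE; exact: measurableU.
move=> t [Bt [k /andP[nk kN] ck]].
have [cn|cn] := lerP c (Z n t); [by left|right; split; first by split => //=; rewrite leNgt cn].
exists k => //; move: nk; rewrite leq_eqVlt => /predU1P[nk|->]; last by rewrite addSnnS.
by move: cn; rewrite nk ltNge ck.
Qed.

Definition reach_ever (c : R) n := [set t | exists2 k, (n <= k)%N & c <= Z k t].

Lemma reach_ever_measurable c n : measurable (reach_ever c n).
Proof.
rewrite (_ : reach_ever c n = \bigcup_(k in [set k | (n <= k)%N]) [set t | c <= Z k t]).
  by apply: bigcup_measurable => k _; exact: (G_measurable (@level_set_adapted k c)).
by apply/seteqP; split => t [k nk ck]; exists k.
Qed.

(** Continuity from below of [P] as the horizon grows. *)
Lemma maximal_ineq (c : R) n B : 0 < c -> (K <= n)%N -> <<s G n >> B ->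
  (P (B `&` reach_ever c n) <= (c^-1 * \int[P]_(t in B) Z n t)%:E)%E.
Proof.
move=> c0 Kn GB; have mB := G_measurable GB.
have -> : B `&` reach_ever c n = \bigcup_N (B `&` reach c n N).
  rewrite -setI_bigcupr; congr (_ `&` _); apply/seteqP; split => t /=.
    by move=> [k nk ck]; exists (k - n)%N => //; exists k; rewrite // nk subnKC/=.
  by move=> [N _ [k /andP[nk _] ck]]; exists k.
have mr N : measurable (B `&` reach c n N) by apply: measurableI => //; exact: reach_measurable.
have := @nondecreasing_cvg_mu _ _ _ P (fun N => B `&` reach c n N) mr (bigcup_measurable (fun k _ => mr k)).
move=> /(_ _)/cvg_lim <-//.
- apply: lime_le.
    apply: ereal_nondecreasing_is_cvgn => i j ij; apply: le_measure; rewrite ?inE//.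
    apply: setIS => t [k /andP[nk kN] ck]; exists k => //.
    by rewrite nk (leq_trans kN)// leq_add2l.
  apply: nearW => N; rewrite -[leLHS]fineK ?fin_num_measure// lee_fin.
  by rewrite ler_pdivlMl// maximal_finite// ltW.
- apply/nondecreasing_seqP => i; apply/subsetPset.
  apply: setIS => t [k /andP[nk kN] ck]; exists k => //.
  by rewrite nk (leq_trans kN)// leq_add2l.
Qed.

End Maximal.

(** * The noisy iteration *)

Section Recursion.
Context {dT : measure_display} {T : measurableType dT} {R : realType}.
Variables (P : probability T R) (d : nat) (H : 'rV[R]_d -> 'rV[R]_d).
Variables (x0 : 'rV[R]_d) (eps : nat -> R) (x w : nat -> T -> 'rV[R]_d) (A : R).
Hypothesis Hn : nonexp H.
Hypothesis eps_gt0 : forall k, 0 < eps k.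
Hypothesis x_0 : forall t, x 0%N t = x0.
Hypothesis x_S : forall k t, x k.+1 t = x k t + eps k *: (H (x k t) - x k t + w k t).
Hypothesis mw : forall k (j : 'I_d), measurable_fun setT (fun t => w k t ord0 j).
Hypothesis iw : forall k (j : 'I_d), P.-integrable setT (fun t => (w k t ord0 j)%:E).
Hypothesis w_mean : forall k (j : 'I_d) B, filt x w k B ->
     (\int[P]_(t in B) (w k t ord0 j)%:E = 0)%E.
Hypothesis w_var : forall k B, filt x w k B ->
     (\int[P]_(t in B) ((norm2 (w k t)) ^+ 2)%:E <= A%:E * P B)%E.

Definition resid k t := norm2 (H (x k t) - x k t) ^+ 2.
Definition sqdist z k t := norm2 (x k t - z) ^+ 2.

(** Each coordinate of [H] is 1-Lipschitz. The source space is left arbitrary so that the result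
    serves both the ambient sigma-algebra and those of the filtration. *)
Lemma H_coord_measurable d' (T' : measurableType d') (f : T' -> 'rV[R]_d) :
  (forall j, measurable_fun setT (fun t => f t ord0 j)) ->
  forall j, measurable_fun setT (fun t => H (f t) ord0 j).
Proof.
move=> mf j; apply: (lipschitz_measurable (g := fun v => H v ord0 j)) => // u v.
rewrite (le_trans _ (Hn u v))// (le_trans _ (norm_coord_le _ j))//.
by rewrite !mxE ler_norm.
Qed.

Lemma x_measurable k (j : 'I_d) : measurable_fun setT (fun t => x k t ord0 j).
Proof.
elim: k j => [|k ih] j; first by under eq_fun do rewrite x_0; exact: measurable_cst.
under eq_fun do rewrite x_S !mxE.
apply: measurable_funD => //; apply: measurable_funM => //; apply: measurable_funD => //.
by apply: measurable_funB => //; exact: H_coord_measurable.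
Qed.

Lemma filt_sub_measurable k : filt x w k `<=` measurable.
Proof. exact: filt_measurable x_measurable mw. Qed.

Lemma filtT k : filt x w k setT.
Proof. by rewrite -setC0; apply: sigma_algebraC; exact: sigma_algebra0. Qed.

Lemma measurable_norm2_sq d' (T' : measurableType d') (f : T' -> 'rV[R]_d) :
  (forall j, measurable_fun setT (fun t => f t ord0 j)) ->
  measurable_fun setT (fun t => norm2 (f t) ^+ 2).
Proof.
move=> mf; apply: measurable_funX; under eq_fun do rewrite -[f _]subr0.
exact: measurable_norm2.
Qed.

Lemma sqdist_filt_measurable z k :
  measurable_fun (setT : set (g_sigma_algebraType (filt_gen x w k)))
    (sqdist z k : g_sigma_algebraType (filt_gen x w k) -> R).
Proof.
apply: measurable_norm2_sq => j; under eq_fun do rewrite !mxE.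
by apply: measurable_funB => //; exact: filt_measurable_coord.
Qed.

Lemma resid_measurable k : measurable_fun setT (resid k).
Proof.
apply: measurable_norm2_sq => j; under eq_fun do rewrite !mxE.
apply: measurable_funB => //; last exact: x_measurable.
by apply: H_coord_measurable => i; exact: x_measurable.
Qed.

Lemma resid_le z k t : H z = z -> resid k t <= 4 * sqdist z k t.
Proof.
move=> Hz; have h1 := norm2_triangle_mid z (H (x k t)) (x k t).
have h2 := Hn (x k t) z; rewrite Hz in h2.
have -> : 4 * sqdist z k t = (2 * norm2 (x k t - z)) ^+ 2 by rewrite exprMn; congr (_ * _); lra.
rewrite lerXn2r ?nnegrE ?mulr_ge0 ?norm2_ge0//.
rewrite (le_trans h1)// (norm2_distC z) mulr_natl mulr2n; exact: lerD.
Qed.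

Lemma w_sq_integrable k : rintegrable P (fun t => norm2 (w k t) ^+ 2).
Proof.
apply/integrableP; split.
  by apply/measurable_EFinP/measurable_norm2_sq => j; exact: mw.
apply: (@le_lt_trans _ _ (A%:E * P setT)%E).
  rewrite (le_trans _ (w_var (@filtT k)))// le_eqVlt; apply/orP; left; apply/eqP.
  by apply: eq_integral => t _; rewrite /= ger0_norm ?sqr_ge0.
by rewrite probability_setT mule1 ltry.
Qed.

(* x_{k+1} - z without its noise term. *)
Definition drift z k t := (x k t - z) + eps k *: (H (x k t) - x k t).

Lemma sqdist_S z k t :
  sqdist z k.+1 t = norm2 (drift z k t) ^+ 2
    + (2 * eps k * dot (w k t) (drift z k t) + eps k ^+ 2 * norm2 (w k t) ^+ 2).
Proof.
have -> : sqdist z k.+1 t = norm2 (drift z k t + eps k *: w k t) ^+ 2.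
  congr (norm2 _ ^+ 2); rewrite x_S /drift.
  by apply/rowP => j; rewrite !mxE; ring.
rewrite norm2_sqD norm2_sqZ dotZr addrA mulrA; congr (_ + _ * _ + _).
by apply: eq_bigr => j _; rewrite mulrC.
Qed.

Lemma drift_measurable z k j : measurable_fun setT (fun t => drift z k t ord0 j).
Proof.
under eq_fun do rewrite !mxE.
apply: measurable_funD; first by apply: measurable_funB => //; exact: x_measurable.
apply: measurable_funM => //; apply: measurable_funB; last exact: x_measurable.
by apply: H_coord_measurable => i; exact: x_measurable.
Qed.

Lemma drift_filt_measurable z k j :
  measurable_fun (setT : set (g_sigma_algebraType (filt_gen x w k)))
    (fun t : g_sigma_algebraType (filt_gen x w k) => drift z k t ord0 j).
Proof.
under eq_fun do rewrite !mxE.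
apply: measurable_funD.
  by apply: measurable_funB => //; exact: filt_measurable_coord.
apply: measurable_funM => //; apply: measurable_funB; last exact: filt_measurable_coord.
by apply: H_coord_measurable => i; exact: filt_measurable_coord.
Qed.

(** Made for integrability with no upper bound on the stepsize: the term [eps k ^+ 2 * resid k t]
    left by [norm2_KM] is absorbed through [resid_le], whence the factor 4. *)
Lemma drift_sq_le z k t : H z = z ->
  norm2 (drift z k t) ^+ 2 <= (1 + 4 * eps k ^+ 2) * sqdist z k t.
Proof.
move=> Hz; apply: (le_trans (norm2_KM _ Hn Hz (eps_gt0 k))).
have := resid_le k t Hz; have := eps_gt0 k; rewrite -/(resid k t) -/(sqdist z k t).
have r0 : 0 <= resid k t by exact: sqr_ge0.
set e := eps k; set r := resid k t in r0 *; set s := sqdist z k t => e0 rs.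
have : e ^+ 2 * r <= e ^+ 2 * (4 * s) by rewrite ler_wpM2l// sqr_ge0.
have : 0 <= e * r by rewrite mulr_ge0// ltW.
nra.
Qed.

Lemma young_dot_coord (u v : 'rV[R]_d) j :
  `|u ord0 j * v ord0 j| <= norm2 u ^+ 2 + norm2 v ^+ 2.
Proof.
rewrite normrM; have := norm_coord_le u j; have := norm_coord_le v j.
have := normr_ge0 (u ord0 j); have := normr_ge0 (v ord0 j).
set a := `|_|; set b := `|_|; set p := norm2 u; set q := norm2 v => a0 b0 aq bp.
have : a ^+ 2 <= q ^+ 2 by rewrite lerXn2r ?nnegrE// (le_trans a0).
have : b ^+ 2 <= p ^+ 2 by rewrite lerXn2r ?nnegrE// (le_trans b0).
have := sqr_ge0 (b - a); nra.
Qed.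

Lemma drift_sq_integrable z k : H z = z -> rintegrable P (sqdist z k) ->
  rintegrable P (fun t => norm2 (drift z k t) ^+ 2).
Proof.
move=> Hz iV; apply: rintegrable_le (rintegrableZ (1 + 4 * eps k ^+ 2) iV).
  by apply: measurable_norm2_sq => j; exact: drift_measurable.
by move=> t; rewrite ger0_norm ?sqr_ge0// drift_sq_le.
Qed.

Lemma w_drift_integrable z k j : H z = z -> rintegrable P (sqdist z k) ->
  rintegrable P (fun t => w k t ord0 j * drift z k t ord0 j).
Proof.
move=> Hz iV.
apply: rintegrable_le (rintegrableD (w_sq_integrable k) (drift_sq_integrable Hz iV)).
  by apply: measurable_funM => //; exact: drift_measurable.
by move=> t; exact: young_dot_coord.
Qed.

(** Induction on [k] through [sqdist_S]; the cross term is integrable because each product of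
    coordinates is dominated by the sum of the two squared norms. *)
Lemma sqdist_integrable z k : H z = z -> rintegrable P (sqdist z k).
Proof.
move=> Hz; elim: k => [|k ih].
  rewrite (_ : sqdist z 0 = cst (norm2 (x0 - z) ^+ 2)); first exact: rintegrable_cst.
  by apply/funext => t; rewrite /sqdist x_0.
rewrite (_ : sqdist z k.+1 = fun t => norm2 (drift z k t) ^+ 2
    + (2 * eps k * dot (w k t) (drift z k t) + eps k ^+ 2 * norm2 (w k t) ^+ 2)); last first.
  by apply/funext => t; exact: sqdist_S.
apply: rintegrableD; first exact: drift_sq_integrable.
apply: rintegrableD; apply: rintegrableZ; last exact: w_sq_integrable.
by apply: rintegrable_sum => j; exact: w_drift_integrable.
Qed.

Lemma resid_integrable z k : H z = z -> rintegrable P (resid k).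
Proof.
move=> Hz; apply: rintegrable_le (rintegrableZ 4 (sqdist_integrable k Hz)).
  exact: resid_measurable.
by move=> t; rewrite ger0_norm ?sqr_ge0// resid_le.
Qed.

(** The drift is known at time [k], so the noise is orthogonal to it, coordinate by coordinate. *)
Lemma w_drift_mean z k B : H z = z -> filt x w k B ->
  \int[P]_(t in B) dot (w k t) (drift z k t) = 0.
Proof.
move=> Hz FB; have mB := filt_sub_measurable FB.
have iV := sqdist_integrable k Hz.
rewrite /Rintegral (eq_integral (fun t => \sum_(j < d) (w k t ord0 j * drift z k t ord0 j)%:E)%E); last first.
  by move=> t _; rewrite sumEFin.
rewrite integral_sum//; last first.
  by move=> j; apply: rintegrableS => //; exact: w_drift_integrable.
rewrite big1// => j _; apply: (integral_mul_eq0 (G := filt_gen x w k)) => //.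
- exact: filt_sub_measurable.
- by move=> B' FB'; exact: w_mean.
- exact: iw.
- exact: drift_filt_measurable.
- exact: w_drift_integrable.
Qed.

(** The one-step conditional inequality, written without conditional expectations by integrating
    over each [B] of the filtration: [norm2_KM] bounds the drift, the cross term vanishes and the
    variance bound controls the rest. *)
Lemma sqdist_step z k B : H z = z -> filt x w k B ->
  \int[P]_(t in B) sqdist z k.+1 t + eps k * (1 - eps k) * \int[P]_(t in B) resid k t
   <= \int[P]_(t in B) sqdist z k t + eps k ^+ 2 * A * fine (P B).
Proof.
move=> Hz FB; have mB := filt_sub_measurable FB.
have iV k' := rintegrableS mB (sqdist_integrable k' Hz).
have iG := rintegrableS mB (resid_integrable k Hz).
have iW := rintegrableS mB (w_sq_integrable k).
have iD : P.-integrable B (EFin \o (fun t => dot (w k t) (drift z k t))).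
  apply: rintegrableS => //; apply: rintegrable_sum => j.
  exact/w_drift_integrable/sqdist_integrable.
have wA : \int[P]_(t in B) (norm2 (w k t) ^+ 2) <= A * fine (P B).
  rewrite -lee_fin -RintegralE//; last exact: w_sq_integrable.
  by rewrite EFinM fineK ?w_var// fin_num_measure.
have iZ a f : P.-integrable B (EFin \o f) -> P.-integrable B (EFin \o (fun t => a * f t)).
  by move=> If; exact: (integrableZl mB a If).
have iAdd f g : P.-integrable B (EFin \o f) -> P.-integrable B (EFin \o g) ->
    P.-integrable B (EFin \o (fun t => f t + g t)).
  by move=> If Ig; exact: (integrableD mB If Ig).
have iG' := iZ (eps k * (1 - eps k)) _ iG.
have iD' := iZ (2 * eps k) _ iD.
have iW' := iZ (eps k ^+ 2) _ iW.
have iN := iAdd _ _ iD' iW'.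
rewrite -RintegralZl// -RintegralD//.
apply: (@le_trans _ _ (\int[P]_(t in B) (sqdist z k t +
   (2 * eps k * dot (w k t) (drift z k t) + eps k ^+ 2 * norm2 (w k t) ^+ 2)))).
  apply: le_Rintegral => //; [exact: (iAdd _ _ (iV _) iG')|exact: (iAdd _ _ (iV _) iN)|].
  move=> t _; rewrite sqdist_S.
  have := norm2_KM (x k t) Hn Hz (eps_gt0 k).
  by rewrite -/(drift z k t) -/(resid k t) -/(sqdist z k t); lra.
rewrite RintegralD// RintegralD// !RintegralZl//.
by rewrite w_drift_mean// mulr0 add0r lerD2l -mulrA ler_wpM2l// sqr_ge0.
Qed.

Lemma expectation_descent z n : H z = z ->
  \int[P]_t sqdist z n.+1 t + eps n * (1 - eps n) * \int[P]_t resid n t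
   <= \int[P]_t sqdist z n t + eps n ^+ 2 * A.
Proof.
move=> Hz; have := sqdist_step Hz (@filtT n).
by rewrite probability_setT/= mulr1.
Qed.

(** The number [n] of summed indices is kept apart from [k]: constant steps use all [k + 1] of them,
    decreasing steps only [k]. *)
Lemma min_resid_le z k n S N : H z = z -> (0 < n <= k.+1)%N ->
  (forall i, eps i < 1) -> 0 < S ->
  S <= \sum_(0 <= i < n) eps i * (1 - eps i) ->
  norm2 (x0 - z) ^+ 2 + \sum_(0 <= i < n) eps i ^+ 2 * A <= N ->
  (\big[Order.min/+oo]_(i < k.+1) \int[P]_t (norm2 (H (x i t) - x i t) ^+ 2)%:E
    <= (N / S)%:E)%E.
Proof.
move=> Hz /andP[n0 nk] eps1 S0 Sle Nle.
have V0 : \int[P]_t sqdist z 0 t = norm2 (x0 - z) ^+ 2.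
  rewrite (_ : sqdist z 0 = fun=> norm2 (x0 - z) ^+ 2); last first.
    by apply/funext => t; rewrite /sqdist x_0.
  rewrite Rintegral_cst// -[RHS]mulr1; congr (_ * _).
  exact: (congr1 fine (probability_setT P)).
have a0 i : 0 < eps i * (1 - eps i) by rewrite mulr_gt0// subr_gt0.
have V_ge0 i : 0 <= \int[P]_t sqdist z i t by apply: Rintegral_ge0 => t _; exact: sqr_ge0.
have r_ge0 i : 0 <= \int[P]_t resid i t by apply: Rintegral_ge0 => t _; exact: sqr_ge0.
rewrite -V0 in Nle.
have [i ni ri] := descent_min (fun i => expectation_descent i Hz) V_ge0 a0 r_ge0 n0 S0 Sle Nle.
apply: (bigmin_inf (Ordinal (leq_trans ni nk))) => //=.
by rewrite (RintegralE measurableT (resid_integrable i Hz)) lee_fin.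
Qed.

(** * Almost sure convergence for square-summable stepsizes *)

Section AlmostSure.
Variables (c : nat -> R) (K : nat).
Hypothesis c_ge0 : forall k, 0 <= c k.
Hypothesis c_S : forall k, c k = c k.+1 + eps k ^+ 2 * A.
Hypothesis c_small : forall e, 0 < e -> exists K : nat, forall k, (K <= k)%N -> c k <= e.
Hypothesis eps_div : forall m M, exists n, M < \sum_(m <= i < n) eps i.
Hypothesis eps_half : forall k, (K <= k)%N -> eps k <= 2^-1.

(* The compensator c k stands for the tail sum A (eps_k^2 + eps_{k+1}^2 + ...). *)
Definition comp_sqdist z k t := sqdist z k t + c k.

Lemma comp_sqdist_integrable z k : H z = z -> rintegrable P (comp_sqdist z k).
Proof.
move=> Hz; apply: (rintegrableD (sqdist_integrable k Hz)).
exact: (rintegrable_cst P (c k)).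
Qed.

Lemma comp_sqdist_adapted z k :
  measurable_fun (setT : set (g_sigma_algebraType (filt_gen x w k)))
    (comp_sqdist z k : g_sigma_algebraType (filt_gen x w k) -> R).
Proof. by apply: measurable_funD => //; exact: sqdist_filt_measurable. Qed.

Lemma comp_sqdist_ge0 z k t : 0 <= comp_sqdist z k t.
Proof. by rewrite addr_ge0// sqr_ge0. Qed.

(** The drop from [c n] to [c n.+1] pays exactly for the noise term of [sqdist_step], and the
    residual term is nonnegative once [eps n <= 1/2]. *)
Lemma comp_sqdist_super z n B : H z = z -> (K <= n)%N -> filt x w n B ->
  \int[P]_(t in B) comp_sqdist z n.+1 t <= \int[P]_(t in B) comp_sqdist z n t.
Proof.
move=> Hz Kn FB; have mB := filt_sub_measurable FB.
have iV k := rintegrableS mB (sqdist_integrable k Hz).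
have ic k := rintegrableS mB (rintegrable_cst P (c k)).
rewrite !RintegralD ?Rintegral_cst//; [|exact: ic|exact: ic].
rewrite (c_S n); have := sqdist_step Hz FB; have := eps_half Kn; have := eps_gt0 n.
have : 0 <= \int[P]_(t in B) resid n t by apply: Rintegral_ge0 => t _; exact: sqr_ge0.
set r := Rintegral _ _ _ => r0 e0 e1.
have : 0 <= eps n * (1 - eps n) * r.
  rewrite mulr_ge0// mulr_ge0 ?(ltW e0)//; set q := eps n in e0 e1 *; lra.
lra.
Qed.

(** For steps at most [1/2], [eps i <= 2 * eps i * (1 - eps i)]; this is the factor 2 in front of
    the telescoped bound. *)
Lemma energy_bound z m n : H z = z -> (K <= m)%N ->
  \sum_(m <= i < n) eps i * \int[P]_t resid i t <= 2 * \int[P]_t comp_sqdist z m t.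
Proof.
move=> Hz Km.
have E0 k : 0 <= \int[P]_t resid k t by apply: Rintegral_ge0 => t _; exact: sqr_ge0.
have C0 k : 0 <= \int[P]_t comp_sqdist z k t.
  by apply: Rintegral_ge0 => t _; exact: comp_sqdist_ge0.
have CE k : \int[P]_t comp_sqdist z k t = \int[P]_t sqdist z k t + c k.
  rewrite RintegralD//; [|exact: sqdist_integrable|exact: (rintegrable_cst P)].
  rewrite Rintegral_cst//; congr (_ + _); rewrite -[RHS]mulr1; congr (_ * _).
  exact: (congr1 fine (probability_setT P)).
have [mn|/ltnW nm] := leqP m n; last by rewrite big_geq// mulr_ge0.
(* The nonnegative terminal term is kept so that the induction on [n] closes. *)
suff : 2 * \int[P]_t comp_sqdist z n t + \sum_(m <= i < n) eps i * \int[P]_t resid i t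
    <= 2 * \int[P]_t comp_sqdist z m t by have := C0 n; lra.
elim: n mn => [|n ih].
  by rewrite leqn0 => /eqP ->; rewrite big_geq// addr0.
rewrite leq_eqVlt => /predU1P[<-|mn]; first by rewrite big_geq// addr0.
rewrite big_nat_recr//=; apply: le_trans (ih mn).
have := expectation_descent n Hz; have := eps_half (leq_trans Km mn); have := eps_gt0 n.
rewrite !CE (c_S n); have := E0 n; set r := Rintegral _ _ (resid n) => r0 e0 e1.
have : 0 <= eps n * (1 - 2 * eps n) * r.
  rewrite mulr_ge0// mulr_ge0 ?(ltW e0)//; set q := eps n in e0 e1 *; lra.
set e := eps n in e0 e1 *; nra.
Qed.

Hypothesis X0 : fixpts H !=set0.
Hypothesis Xb : bounded2 (fixpts H).

Definition frequently_far (e : R) :=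
  [set t | forall m : nat, exists2 k, (m <= k)%N & e <= dist_set (x k t) (fixpts H)].

Lemma frequently_far_measurable e : measurable (frequently_far e).
Proof.
have md k : measurable [set t | e <= dist_set (x k t) (fixpts H)].
  have := @lipschitz_measurable _ T R d (x k) (fun u => dist_set u (fixpts H))
    (fun u v => dist_set_lip u v X0) (x_measurable k) measurableT
    `[e, +oo[%classic (measurable_itv _).
  by rewrite setTI set_itvcy.
rewrite (_ : frequently_far e = \bigcap_m \bigcup_(k in [set k | (m <= k)%N])
    [set t | e <= dist_set (x k t) (fixpts H)]).
  by apply: bigcapT_measurable => m; apply: bigcup_measurable => k _.
apply/seteqP; split => t h m; first by move=> _; have [k mk ek] := h m; exists k.
by have [k mk ek] := h m I; exists k.
Qed.

Let super_reach z := @maximal_ineq _ T R P (filt_gen x w) (@filt_sub _ T R d x w)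
  filt_sub_measurable (comp_sqdist z) K (comp_sqdist_adapted z) (comp_sqdist_ge0 z).

(** By the maximal inequality, level [M + 1] is reached after time [K] with probability at most
    [C / (M + 1)], which tends to 0. *)
Lemma unbounded_null z : H z = z ->
  let U := \bigcap_M reach_ever (comp_sqdist z) M.+1%:R K in measurable U /\ P U = 0%E.
Proof.
move=> Hz U.
have mr M : measurable (reach_ever (comp_sqdist z) M.+1%:R K).
  exact: (reach_ever_measurable filt_sub_measurable (comp_sqdist_adapted z)).
have mU : measurable U by exact: bigcapT_measurable.
split => //; apply/eqP; rewrite eq_le measure_ge0 andbT.
apply/lee_addgt0Pr => e e0; rewrite add0e.
set C := \int[P]_t comp_sqdist z K t.
have C0 : 0 <= C by apply: Rintegral_ge0 => t _; exact: comp_sqdist_ge0.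
have [M Me] : exists M : nat, C / e < M.+1%:R.
  by exists (Num.truncn (C / e)); exact: truncnS_gt.
apply: (@le_trans _ _ (P (setT `&` reach_ever (comp_sqdist z) M.+1%:R K))).
  by apply: le_measure; rewrite ?inE ?setTI// => t; exact.
apply: le_trans (super_reach _ _ _ _ _) _ => //.
- by move=> n; exact: comp_sqdist_integrable.
- by move=> n B; exact: comp_sqdist_super.
- exact: filtT.
- rewrite lee_fin ler_pdivrMl// mulrC -ler_pdivrMl//.
  by rewrite mulrC ltW.
Qed.

Lemma frequently_far_null (e : R) : 0 < e -> P (frequently_far e) = 0%E.
Proof.
move=> e0; have [z Hz] := X0.
have [mU PU] := unbounded_null Hz; set U := \bigcap_M _ in mU PU.
(* On [S l m] the residual stays away from 0 from some time on; bounded energy against divergent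
   stepsizes makes this null. *)
pose S l m := [set t | forall n, (maxn K m <= n)%N -> l.+1%:R^-1 <= resid n t].
have Snull l m : measurable (S l m) /\ P (S l m) = 0%E.
  apply: (null_of_divergence (a := eps) (C := 2 * \int[P]_t comp_sqdist z (maxn K m) t)) => //.
  - by move=> n; exact: resid_integrable Hz.
  - by move=> n t; exact: sqr_ge0.
  - by move=> n; exact: ltW.
  - by move=> n; apply: energy_bound => //; exact: leq_maxl.
pose N := U `|` \bigcup_l \bigcup_m S l m.
have Nnull : P.-negligible N.
  apply: negligibleU; first by exists U; split.
  apply: negligible_bigcup => l; apply: negligible_bigcup => m.
  by have [? ?] := Snull l m; exists (S l m); split.
have mF := frequently_far_measurable e.
suff key g : 0 < g -> (P (frequently_far e) <= (5 * g ^+ 2 / e ^+ 2)%:E)%E.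
  apply/eqP; rewrite eq_le measure_ge0 andbT.
  apply/lee_addgt0Pr => h h0; rewrite add0e.
  (* Chosen so that [5 * g ^+ 2 / e ^+ 2] equals [h]. *)
  pose g := Num.sqrt (h * e ^+ 2 / 5).
  have hg : 0 < h * e ^+ 2 / 5 by rewrite !mulr_gt0 ?invr_gt0// exprn_gt0.
  apply: le_trans (key g _) _; first by rewrite sqrtr_gt0.
  rewrite lee_fin sqr_sqrtr ?(ltW hg)//.
  have -> : 5 * (h * e ^+ 2 / 5) / e ^+ 2 = h by field; rewrite gt_eqF.
  exact: lexx.
move=> g0.
have [r [y [r0 Hy yP]]] := fixpts_net Xb Hn X0 g0.
have [K1 K1P] := c_small (exprn_gt0 2 g0).
pose m := maxn K K1.
(* The pair (time n, net point y_j) is coded by i = (n - m) r + j, so that the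
   disjointification of E picks the first visit. *)
pose idx i := (m + i %/ r)%N.
pose ctr i := y (i %% r)%N.
have idx_mono i j : (i <= j)%N -> (idx i <= idx j)%N.
  by move=> ij; rewrite leq_add2l leq_div2r.
(* The level is [(2 g)^2 + g^2]: the iterate is within [g] of a cluster point, which is within [g]
   of the net, and the compensator is at most [g ^+ 2] after time [K1]. *)
pose E i := [set t | comp_sqdist (ctr i) (idx i) t < 5 * g ^+ 2].
have FE i : filt x w (idx i) (E i).
  have := @comp_sqdist_adapted (ctr i) (idx i) measurableT `]-oo, 5 * g ^+ 2[%classic (measurable_itv _).
  by rewrite setTI set_itvNyo.
pose D i := seqDU E i.
(* The removed events [E j] have [j < i], hence happen no later than time [idx i]. *)
have FD i : filt x w (idx i) (D i).
  apply: (@measurableD _ (g_sigma_algebraType (filt_gen x w (idx i)))); first exact: FE.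
  rewrite -bigcup_mkord; apply: bigcup_measurable => j /= ji.
  by apply: (filt_sub (idx_mono _ _ (ltnW ji))); exact: FE.
have mD i : measurable (D i) by exact: filt_sub_measurable (FD i).
pose W i := D i `&` reach_ever (comp_sqdist (ctr i)) (e ^+ 2) (idx i).
have mW i : measurable (W i).
  apply: measurableI => //.
  exact: (reach_ever_measurable filt_sub_measurable (comp_sqdist_adapted (ctr i))).
have PW i : (P (W i) <= (5 * g ^+ 2 / e ^+ 2)%:E * P (D i))%E.
  apply: le_trans (super_reach _ _ _ _ _) _.
  - by move=> n; apply: comp_sqdist_integrable; exact: Hy.
  - by move=> n B; apply: comp_sqdist_super; exact: Hy.
  - by rewrite exprn_gt0.
  - exact: leq_trans (leq_maxl K K1) (leq_addr _ _).
  - exact: FD.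
  - rewrite -[P (D i)]fineK ?fin_num_measure// lee_fin mulrC mulrAC.
    rewrite ler_pM2r ?invr_gt0 ?exprn_gt0// -Rintegral_cst//; apply: le_Rintegral => //.
    + by apply: rintegrableS => //; exact: comp_sqdist_integrable (Hy _).
    + exact: finite_measure_integrable_cst.
    + by move=> t [Et _]; exact: ltW.
have sub : frequently_far e `<=` N `|` \bigcup_i W i.
  move=> t far; have [Nt|nN] := pselect (N t); [by left|right].
  (* Outside [U] some level is never reached from time [K] on. *)
  have [M MP] : exists M : nat, forall k, (K <= k)%N -> comp_sqdist z k t < M.+1%:R.
    apply: contrapT => nM; apply: nN; left => M _; apply: contrapT => nr; apply: nM.
    exists M => k Kk; rewrite ltNge; apply/negP => Mk; apply: nr.
    by exists k.
  have bound n : norm2 (x (m + n) t) <= M.+1%:R + norm2 z.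
    rewrite -{1}(subrK z (x _ t)) (le_trans (norm2_triangle _ _))// lerD2r.
    have := MP (m + n)%N (leq_trans (leq_maxl _ _) (leq_addr _ _)).
    rewrite /comp_sqdist /sqdist; have := c_ge0 (m + n); have := norm2_ge0 (x (m + n)%N t - z).
    (* As [b >= 1], having [q > b] would force [q ^+ 2 > b]. *)
    have M1 : 1 <= M.+1%:R :> R by rewrite ler1n.
    set q := norm2 _; set b := M.+1%:R in M1 *; set cc := c _ => q0 c0 h.
    rewrite leNgt; apply/negP => bq; nra.
  have small h : 0 < h -> forall n : nat, exists k, (n <= k)%N /\
      norm2 (H (x (m + k)%N t) - x (m + k)%N t) < h.
    move=> h0 n; apply: contrapT => nex; apply: nN; right.
    (* [resid] is a squared norm, so the threshold [1 / (l + 1)] is taken below [h ^+ 2]. *)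
    have [l lP] : exists l : nat, (h ^+ 2)^-1 < l.+1%:R.
      by exists (Num.truncn (h ^+ 2)^-1); exact: truncnS_gt.
    exists l => //; exists (m + n)%N => // k; rewrite geq_max => /andP[_ mnk].
    rewrite leNgt; apply/negP => rk; apply: nex; exists (k - m)%N.
    have mk : (m <= k)%N by rewrite (leq_trans _ mnk)// leq_addr.
    rewrite subnKC//; split; first by rewrite leq_subRL.
    rewrite -(ltr_pXn2r (_ : 0 < 2)%N) ?nnegrE ?norm2_ge0 ?ltW//.
    apply: (lt_trans rk); rewrite -[ltRHS]invrK ltf_pV2 ?posrE ?invr_gt0 ?exprn_gt0//.
  have [p Hp pP] := fix_cluster Hn bound small.
  have [n [_ np]] := pP g g0 0%N.
  have [j [jr pj]] := yP p Hp.
  have ED : (\bigcup_i E i) t.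
    (* Since [j < r], this index decodes to the time [m + n] and the centre [y j]. *)
    exists (n * r + j)%N => //; rewrite /E /idx /ctr /= divnMDl// divn_small// addn0.
    rewrite modnMDl modn_small// /comp_sqdist /sqdist.
    have := K1P (m + n)%N (leq_trans (leq_maxr _ _) (leq_addr _ _)).
    have qg : norm2 (x (m + n)%N t - y j) < 2 * g.
      by rewrite (le_lt_trans (norm2_triangle_mid p _ _))// mulr_natl mulr2n ltrD.
    set cc := c _; set q := norm2 _ in qg * => cg.
    have : q ^+ 2 < (2 * g) ^+ 2 by rewrite ltr_pXn2r ?nnegrE ?norm2_ge0 ?mulr_ge0 ?(ltW g0).
    by rewrite exprMn; lra.
  rewrite seqDU_bigcup_eq in ED; have [i _ Di] := ED.
  have [k ik ek] := far (idx i).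
  exists i => //; split => //; exists k => //.
  (* The centre is a fixed point, so being [e]-far from the fixed-point set means being [e]-far from
     the centre. *)
  apply: (@le_trans _ _ (sqdist (ctr i) k t)); last by rewrite lerDl.
  rewrite lerXn2r ?nnegrE ?norm2_ge0 ?(ltW e0)//.
  by apply: (le_trans ek); apply: dist_set_le; exact: Hy.
have [N0 [mN0 PN0 NN0]] := Nnull.
have mWU : measurable (\bigcup_i W i) by exact: bigcup_measurable.
have C0 : 0 <= 5 * g ^+ 2 / e ^+ 2 by apply: divr_ge0; [apply: mulr_ge0 => //|]; exact: sqr_ge0.
apply: (@le_trans _ _ (P (\bigcup_i W i `|` N0))).
  apply: le_measure; rewrite ?inE//; first exact: measurableU.
  by move=> t /sub [/NN0|]; [right|left].
rewrite measureU0//.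
apply: (@le_trans _ _ (\sum_(0 <= i <oo) P (W i))%E).
  by apply: measure_sigma_subadditive.
(* The first-visit events [D i] are disjoint, so their probabilities sum to at most 1. *)
apply: (@le_trans _ _ (\sum_(0 <= i <oo) ((5 * g ^+ 2 / e ^+ 2)%:E * P (D i)))%E).
  by apply: lee_nneseries => // i _.
rewrite nneseriesZl//.
rewrite -measure_semi_bigcup//; [|exact: trivIset_seqDU|exact: bigcup_measurable].
rewrite -[leRHS]mule1; apply: lee_pmul => //.
by apply: probability_le1; exact: bigcup_measurable.
Qed.

(** Failure of convergence means being frequently at distance at least [1 / (l + 1)] for some [l], a
    countable union of null events. *)
Lemma dist_cvg0_ae :
  {ae P, forall t, (fun k => dist_set (x k t) (fixpts H)) @ \oo --> 0}.
Proof.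
apply: (@negligibleS _ _ _ _ (\bigcup_l frequently_far l.+1%:R^-1)); last first.
  apply: negligible_bigcup => l; exists (frequently_far l.+1%:R^-1); split => //.
    exact: frequently_far_measurable.
  exact: frequently_far_null.
move=> t nc; apply: contrapT => nf; apply: nc; apply/cvgrPdist_lt => e e0.
have [l le] : exists l : nat, e^-1 < l.+1%:R.
  by exists (Num.truncn e^-1); exact: truncnS_gt.
have [m mP] : exists m : nat, forall k, (m <= k)%N -> dist_set (x k t) (fixpts H) < l.+1%:R^-1.
  apply: contrapT => nm; apply: nf; exists l => // m; apply: contrapT => nk; apply: nm.
  by exists m => k mk; rewrite ltNge; apply/negP => kl; apply: nk; exists k.
exists m => // k mk /=; rewrite sub0r normrN ger0_norm ?dist_set_ge0//.
apply: (lt_trans (mP k mk)); rewrite -[ltRHS]invrK ltf_pV2 ?posrE ?invr_gt0//.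
Qed.

End AlmostSure.

End Recursion.

(** * Assembly of the four claims *)

Lemma dist_le_sup {R : realType} {d : nat} (X : set 'rV[R]_d) (x z : 'rV[R]_d) :
  bounded2 X -> X z -> norm2 (x - z) <= sup [set norm2 (x - y) | y in X].
Proof.
move=> [M XM] Xz; apply: ub_le_sup; last by exists z.
exists (norm2 x + M) => _ [y Xy <-].
by rewrite (le_trans (norm2_triangle _ _))// norm2N lerD2l XM.
Qed.

Theorem theorem2 (dT : measure_display) (T : measurableType dT) (R : realType)
  (P : probability T R) (d : nat)
  (H : 'rV[R]_d -> 'rV[R]_d)
  (x0 : 'rV[R]_d) (eps : nat -> R) (x w : nat -> T -> 'rV[R]_d) (A : R) :
  (forall u v, norm2 (H u - H v) <= norm2 (u - v)) ->
  fixpts H !=set0 -> bounded2 (fixpts H) ->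
  (forall k, 0 < eps k) ->
  (forall t, x 0%N t = x0) ->
  (forall k t, x k.+1 t = x k t + eps k *: (H (x k t) - x k t + w k t)) ->
  (forall k (j : 'I_d), measurable_fun setT (fun t => w k t ord0 j)) ->
  0 < A ->
  (* E[w_k | F_k] = 0 *)
  (forall k (j : 'I_d), P.-integrable setT (fun t => (w k t ord0 j)%:E)) ->
  (forall k (j : 'I_d) B, filt x w k B ->
     (\int[P]_(t in B) (w k t ord0 j)%:E = 0)%E) ->
  (* E[||w_k||^2 | F_k] <= A *)
  (forall k B, filt x w k B ->
     (\int[P]_(t in B) ((norm2 (w k t)) ^+ 2)%:E <= A%:E * P B)%E) ->
  let D := sup [set norm2 (x0 - y) | y in fixpts H] in
  let Err i := (\int[P]_t ((norm2 (H (x i t) - x i t)) ^+ 2)%:E)%E in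
  let minErr k := \big[Order.min/+oo%E]_(i < k.+1) Err i in
  (* (a) *)
  ((\sum_(k <oo) (eps k)%:E = +oo)%E -> (\sum_(k <oo) ((eps k) ^+ 2)%:E < +oo)%E ->
     {ae P, forall t, (fun k => dist_set (x k t) (fixpts H)) @ \oo --> 0}) /\
  (* (b) *)
  (forall e : R, 0 < e < 1 -> (forall k, eps k = e) ->
     forall k : nat, (minErr k <=
       (D ^+ 2 / ((k.+1)%:R * (1 - e) * e) + A * e / (1 - e))%:E)%E) /\
  (* (c) *)
  (forall e : R, 0 < e < 1 -> (forall k, eps k = e / Num.sqrt (k.+1)%:R) ->
     forall k : nat, (0 < k)%N -> (minErr k <=
       ((D ^+ 2 + A * e ^+ 2 * (1 + ln k%:R)) /
        (2 * (1 - e) * e * (Num.sqrt (k.+1)%:R - 1)))%:E)%E) /\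
  (* (d) *)
  (forall e : R, 0 < e < 1 -> (forall k, eps k = e / (k.+1)%:R) ->
     forall k : nat, (0 < k)%N -> (minErr k <=
       ((D ^+ 2 + 2 * A * e ^+ 2) / ((1 - e) * e) * (ln (k.+1)%:R)^-1)%:E)%E).

Proof.
move=> Hn X0 Xb eps0 x_0 x_S mw A0 iw w_mean w_var D Err minErr.
have [z Hz] := X0.
have Dz : norm2 (x0 - z) ^+ 2 <= D ^+ 2.
  (* Boundedness of the fixed-point set enters here: it makes the supremum [D] a genuine upper
     bound. *)
  have zD : norm2 (x0 - z) <= D by exact: dist_le_sup.
  by rewrite lerXn2r ?nnegrE ?norm2_ge0// (le_trans _ zD)// norm2_ge0.
have min_le := min_resid_le Hn eps0 x_0 x_S mw iw w_mean w_var Hz.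
split=> [div sq|].
  have [c [c0 cS csmall]] := series_tail (fun i => sqr_ge0 (eps i)) sq.
  (* The tail [c k] dominates its first term [eps k ^+ 2], so a tail below [(1/2)^2] yields
     [eps k <= 1/2]. *)
  have [K KP] := csmall _ (exprn_gt0 2 (ltac:(by rewrite invr_gt0) : 0 < 2^-1 :> R)).
  have eps_half k : (K <= k)%N -> eps k <= 2^-1.
    move=> Kk; rewrite -(ler_pXn2r (_ : 0 < 2)%N) ?nnegrE ?invr_ge0 ?(ltW (eps0 k))//.
    by apply: le_trans (KP k Kk); rewrite (cS k) lerDr.
  apply: (dist_cvg0_ae Hn eps0 x_0 x_S mw iw w_mean w_var (c := fun k => c k * A) (K := K)) => //.
  - by move=> k; rewrite mulr_ge0// ltW.
  - by move=> k; rewrite (cS k) mulrDl.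
  - move=> e e0; have [L LP] := csmall (e / A) (divr_gt0 e0 A0).
    by exists L => k Lk; rewrite -ler_pdivlMr// LP.
  - by apply: series_divergent => // i; exact: ltW.
split=> [e /andP[e0 e1] epsE k|].
  have e1' : 0 < 1 - e by rewrite subr_gt0.
  (* The bound as a single quotient: [k + 1] noise terms [e ^+ 2 * A] over [k + 1] weights
     [e * (1 - e)]. *)
  have -> : D ^+ 2 / (k.+1%:R * (1 - e) * e) + A * e / (1 - e)
      = (D ^+ 2 + k.+1%:R * (e ^+ 2 * A)) / (k.+1%:R * (e * (1 - e))).
    have k0 : 0 < k.+1%:R :> R by [].
    by move: k0; set m := k.+1%:R => k0; field; rewrite !gt_eqF.
  apply: (min_le k k.+1); rewrite ?leqnn//.
  - by move=> i; rewrite epsE.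
  - by rewrite !mulr_gt0.
  - by under eq_bigr do rewrite epsE; rewrite sumr_const_nat subn0 mulr_natl.
  - by under eq_bigr do rewrite epsE; rewrite sumr_const_nat subn0 mulr_natl lerD2r.
(* As [g i >= 1], every step is at most [e], so each weight is at least [(1 - e) * eps i]. *)
have decreasing_steps (e : R) (g : nat -> R) : 0 < e < 1 -> (forall i, 1 <= g i) ->
    (forall i, eps i = e / g i) -> (forall i, eps i < 1) /\
    forall n, (1 - e) * e * \sum_(0 <= i < n) (g i)^-1 <=
      \sum_(0 <= i < n) eps i * (1 - eps i).
  move=> /andP[e0 e1] g1 epsE.
  have epse i : eps i <= e.
    by rewrite epsE ler_pdivrMr ?(lt_le_trans ltr01)// ler_peMr// ltW.
  split=> [i|n]; first exact: le_lt_trans (epse i) e1.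
  rewrite mulr_sumr; apply: ler_sum => i _; rewrite -mulrA -epsE mulrC.
  by rewrite ler_pM2l// lerD2l lerN2.
split=> e e01 epsE k k0; have [e0 e1] := andP e01; have e1' : 0 < 1 - e by rewrite subr_gt0.
- have g1 (i : nat) : 1 <= Num.sqrt i.+1%:R :> R.
    by rewrite -[leLHS]sqrtr1 ler_sqrt// ler1n.
  have [eps1 Sle] := decreasing_steps e _ e01 g1 epsE.
  (* Summing only [i < k] gives [1 + ln k] in the numerator and [sqrt (k + 1) - 1], positive for
     [k >= 1], in the denominator. *)
  apply: (min_le k k) => //.
  + by rewrite k0 leqnSn.
  + by rewrite !mulr_gt0// subr_gt0 -[ltLHS]sqrtr1 ltr_sqrt// ltr1n ltnS.
  + apply: le_trans (Sle k).
    rewrite -(mulrA 2) (mulrC 2) -(mulrA _ 2) ler_wpM2l ?mulr_ge0 ?(ltW e0) ?(ltW e1')//.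
    exact: sum_inv_sqrt_ge.
  + rewrite lerD// -mulr_suml mulrC -mulrA ler_pM2l//.
    under eq_bigr do rewrite epsE expr_div_n sqr_sqrtr//.
    by rewrite -mulr_sumr ler_pM2l ?exprn_gt0// sum_inv_le_ln.
- have g1 (i : nat) : 1 <= i.+1%:R :> R by rewrite ler1n.
  have [eps1 Sle] := decreasing_steps e _ e01 g1 epsE.
  rewrite -mulrA -invfM.
  (* Over [i < k] the harmonic sum is at least [ln (k + 1)], positive for [k >= 1], and the inverse
     squares sum to at most 2. *)
  apply: (min_le k k) => //.
  + by rewrite k0 leqnSn.
  + by rewrite !mulr_gt0// ln_gt0// ltr1n ltnS.
  + apply: le_trans (Sle k); rewrite ler_wpM2l ?mulr_ge0 ?(ltW e0) ?(ltW e1')//.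
    exact: ln_le_sum_inv.
  + rewrite lerD// -mulr_suml mulrC (mulrC 2) -!mulrA ler_pM2l//.
    under eq_bigr do rewrite epsE expr_div_n.
    by rewrite -mulr_sumr mulrC ler_pM2r ?exprn_gt0// sum_inv_sq_le.
Qed.
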